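(* Let $H$ satisfy the standing assumptions (H), let $m\in\mathscr C^{1,2}_{\mathrm{per}}((0,T)\times\mathbb T^d)$ and for $\mu>0$ let $\lambda_H(m,\mu)$ be the eigenvalue of $\partial_t+\mu(-\Delta+H(\nabla_x\cdot))+m$. Then \[-\lambda_H(m,\mu)\xrightarrow[\mu\to0]{}\max_{x\in\mathbb T^d}\frac1T\int_0^Tm(t,x)\,dt,\qquad -\lambda_H(m,\mu)\xrightarrow[\mu\to\infty]{}\frac1{T|\mathbb T^d|}\iint_{(0,T)\times\mathbb T^d}m.\]
   Context: $\mathbb T^d$ is the $d$-dimensional torus and $T>0$ is fixed. $\mathscr C^{1,2}_{\mathrm{per}}((0,T)\times\mathbb T^d)$ denotes functions that are $T$-periodic in $t$, $\mathbb T^d$-periodic in $x$, $\mathscr C^1$ in $t$ and $\mathscr C^2$ in $x$. Standing assumptions (H) on $H:\mathbb R^d\to\mathbb R$: $H$ is $\mathscr C^2$; $H(p)>H(0)=0$ for $p\neq0$; $\nabla^2_{pp}H(p)$ is symmetric positive definite for $p\neq 0$; there is a continuous, coercive, convex, non-negative function $\mathcal H$ on $[0,\infty)$ with $\mathcal H(a)>\mathcal H(0)=0$ for $a>0$ such that $\mathcal H\big(\|f-\frac{1}{|\mathbb T^d|}\int_{\mathbb T^d}f\|_{L^1(\mathbb T^d)}\big)\le\int_{\mathbb T^d}H(\nabla f)$ for every $f\in\mathscr C^2(\mathbb T^d)$; and there is $\beta\in(0,1)$ with $aH(p)\ge H(a^\beta p)$ for all $a\in(0,1)$, $p\in\mathbb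 R^d$. Eigenvalue: the eigenvalue of $\partial_t+\mu(-\Delta+H(\nabla_x\cdot))+m$ is the unique real $\lambda$ for which there exists $\varphi\in\mathscr C^{1,2}_{\mathrm{per}}((0,T)\times\mathbb T^d)$ with $\lambda+\partial_t\varphi+\mu(-\Delta\varphi+H(\nabla_x\varphi))=-m$. *)

(* Defs.v *)
From HB Require Import structures.
From mathcomp Require Import all_boot all_order all_algebra.
From mathcomp Require Import all_classical all_reals all_analysis.
Set Implicit Arguments. Unset Strict Implicit. Unset Printing Implicit Defensive.
Import Order.TTheory GRing.Theory Num.Theory.
Import numFieldNormedType.Exports.
Local Open Scope classical_set_scope.
Local Open Scope ring_scope.

Definition evec (R : realType) (d : nat) (i : 'I_d) : 'rV[R]_d := delta_mx 0 i.

Definition pdx (R : realType) (d : nat) (i : 'I_d) (g : 'rV[R]_d -> R) (x : 'rV[R]_d) : R :=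
  'D_(evec R i) g x.

Definition grad (R : realType) (d : nat) (g : 'rV[R]_d -> R) (x : 'rV[R]_d) : 'rV[R]_d :=
  \row_i pdx i g x.
Definition lap (R : realType) (d : nat) (g : 'rV[R]_d -> R) (x : 'rV[R]_d) : R :=
  \sum_(i < d) pdx i (pdx i g) x.

Definition pdt (R : realType) (d : nat) (phi : R -> 'rV[R]_d -> R) (t : R) (x : 'rV[R]_d) : R :=
  'D_1 (fun s => phi s x) t.

Definition C2 (R : realType) (d : nat) (g : 'rV[R]_d -> R) : Prop :=
  [/\ continuous g,
      (forall i x, derivable g x (evec R i)),
      (forall i, continuous (pdx i g)),
      (forall i j x, derivable (pdx j g) x (evec R i)) &
      (forall i j, continuous (pdx i (pdx j g)))].

(* periodicity on the (unit) torus T^d = R^d / Z^d *)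
Definition xperiodic (R : realType) (d : nat) (g : 'rV[R]_d -> R) : Prop :=
  forall i x, g (x + evec R i) = g x.

Definition C2_torus (R : realType) (d : nat) (g : 'rV[R]_d -> R) : Prop :=
  C2 g /\ xperiodic g.

Definition C12per (R : realType) (d : nat) (T : R) (phi : R -> 'rV[R]_d -> R) : Prop :=
  (forall t x, phi (t + T) x = phi t x) /\
  (forall t, xperiodic (phi t)) /\
  continuous (fun p : R * 'rV[R]_d => phi p.1 p.2) /\
  (forall t x, derivable (fun s => phi s x) t 1) /\
  continuous (fun p : R * 'rV[R]_d => pdt phi p.1 p.2) /\
  (forall i t x, derivable (phi t) x (evec R i)) /\
  (forall i, continuous (fun p : R * 'rV[R]_d => pdx i (phi p.1) p.2)) /\
  (forall i j t x, derivable (pdx j (phi t)) x (evec R i)) /\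
  (forall i j, continuous (fun p : R * 'rV[R]_d => pdx i (pdx j (phi p.1)) p.2)).

Definition int_ab (R : realType) (a b : R) (f : R -> R) : R :=
  \int[@lebesgue_measure R]_(s in `[a, b]) f s.

(* iterated integral over the unit cube [0,1]^n of f : (nat -> R) -> R,
   integrating the coordinates 0, ..., n-1 (other coordinates set to 0) *)
Fixpoint icube (R : realType) (n : nat) (f : (nat -> R) -> R) : R :=
  match n with
  | 0 => f (fun _ => 0)
  | n'.+1 => int_ab 0 1 (fun s => icube n' (fun x => f (fun k => if k == n' then s else x k)))
  end.

(* integral over the torus T^d = [0,1)^d (|T^d| = 1) *)
Definition torus_int (R : realType) (d : nat) (g : 'rV[R]_d -> R) : R :=
  icube d (fun x => g (\row_i x (nat_of_ord i))).

Definition posdef (R : realType) (d : nat) (A : 'M[R]_d) : Prop :=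
  forall v : 'rV[R]_d, v != 0 -> 0 < (v *m A *m v^T) 0 0.

Definition hessian (R : realType) (d : nat) (H : 'rV[R]_d -> R) (p : 'rV[R]_d) : 'M[R]_d :=
  \matrix_(i, j) pdx i (pdx j H) p.

Definition assumptionsH (R : realType) (d : nat) (H : 'rV[R]_d -> R) : Prop :=
  C2 H /\
      H 0 = 0 /\
      (forall p, p != 0 -> 0 < H p) /\
      (forall p, p != 0 -> (hessian H p)^T = hessian H p /\ posdef (hessian H p)) /\
      (exists calH : R -> R,
         {within `[0, +oo[, continuous calH} /\
         calH x @[x --> +oo] --> +oo /\
         (forall a b t, 0 <= a -> 0 <= b -> 0 <= t <= 1 ->
            calH (t * a + (1 - t) * b) <= t * calH a + (1 - t) * calH b) /\
         (forall a, 0 <= a -> 0 <= calH a) /\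
         calH 0 = 0 /\
         (forall a, 0 < a -> 0 < calH a) /\
         (forall f : 'rV[R]_d -> R, C2_torus f ->
            calH (torus_int (fun x => `| f x - torus_int f |))
            <= torus_int (fun x => H (grad f x)))) /\
      (exists beta : R, [/\ 0 < beta, beta < 1 &
         forall a p, 0 < a -> a < 1 -> H (a `^ beta *: p) <= a * H p]).

Definition is_eigenvalue (R : realType) (d : nat) (T : R) (H : 'rV[R]_d -> R)
    (m : R -> 'rV[R]_d -> R) (mu lambda : R) : Prop :=
  exists phi : R -> 'rV[R]_d -> R, C12per T phi /\
    forall t x, lambda + pdt phi t x + mu * (- lap (phi t) x + H (grad (phi t) x)) = - m t x.

(* Main.v *)
Require Import Defs.
From HB Require Import structures.
From mathcomp Require Import all_boot all_order all_algebra.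
From mathcomp Require Import all_classical all_reals all_analysis.
From mathcomp Require Import ring lra zify.
Import Order.TTheory GRing.Theory Num.Theory.
Import numFieldNormedType.Exports.
Local Open Scope classical_set_scope.
Local Open Scope ring_scope.
Set Implicit Arguments.
Unset Strict Implicit.

(** Write F[psi] = m + psi_t + mu (- lap psi + H(grad psi)), so that the
    eigenfunction phi satisfies F[phi] = - lambda. At a maximum point of
    phi - psi one has - lambda >= F[psi], at a minimum point - lambda <= F[psi],
    so everything reduces to choosing test functions psi.

    For mu -> 0, let psi0 be T-periodic with psi0_t = mean m - m, where mean m is
    the time average. Testing with psi0 gives - lambda <= max (mean m) + O(mu).
    For the lower bound test with psi0 + L |x - x0|^2, which is not periodic but
    still leaves a maximum point: away from x0 its gradient is of order L, and
    H(a^beta p) <= a H(p) makes mu H(grad psi) as large as wanted for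
    L ~ mu^-beta, while mu L -> 0.

    For mu -> oo, test with a(t) + w(t,x) / mu where lap w is uniformly close to
    m minus its mean in x. Such a w is explicit once m(t,.) is replaced by its
    discrete Fejer approximation on a grid, a trigonometric polynomial in x.
    Superlinearity gives mu H(grad w / mu) <= mu^(1 - 1/beta) H(grad w) -> 0. *)

(** * Integrals and derivatives of functions of one real variable *)

(** The argument has no bound on [phi] uniform in [mu]: [phi] enters only at touching points, where
    the derivatives of the test function stand in for its own.

    The exponent in L ~ mu^-beta comes from the oscillation M of mean m, which mu H(p) must beat. If
    H >= c outside the unit ball and a = c mu / M, then c <= H(a^beta p) <= a H(p) gives mu H(p) >=
    M as soon as |p| >= a^-beta. The Laplacian of the penalty then costs mu L ~ mu^(1-beta), which
    vanishes because beta < 1.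

    For mu -> oo, solving the Poisson equation exactly would call for regularity theory, whereas
    comparison tolerates a small uniform error and a trigonometric polynomial is inverted mode by
    mode. Sampling on a grid instead of taking Fourier coefficients makes the coefficients multiples
    of m(t, y_j), with time derivatives m_t(t, y_j), so w_t is bounded at once. The price is that
    the mean in x becomes a grid mean; integrating the same uniform estimate over the torus controls
    the difference. *)

Lemma cont_cst (R : realType) (U : topologicalType) (c : R) :
  continuous (fun _ : U => c).
Proof. by move=> x; exact: cvg_cst. Qed.

Lemma cont_add (R : realType) (U : topologicalType) (f g : U -> R) :
  continuous f -> continuous g -> continuous (fun x => f x + g x).
Proof. by move=> cf cg x; apply: (@continuousD _ _ _ f g); [exact: cf|exact: cg]. Qed.

Lemma cont_sub (R : realType) (U : topologicalType) (f g : U -> R) :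
  continuous f -> continuous g -> continuous (fun x => f x - g x).
Proof. by move=> cf cg x; apply: (@continuousB _ _ _ f g); [exact: cf|exact: cg]. Qed.

Lemma cont_mul (R : realType) (U : topologicalType) (f g : U -> R) :
  continuous f -> continuous g -> continuous (fun x => f x * g x).
Proof. by move=> cf cg x; apply: (@continuousM _ _ f g); [exact: cf|exact: cg]. Qed.

Lemma integrable_cont (R : realType) (a b : R) (f : R -> R) : continuous f ->
  (@lebesgue_measure R).-integrable `[a, b] (EFin \o f).
Proof.
move=> cf; apply: (@continuous_compact_integrable R f `[a, b]).
  exact: segment_compact.
exact: continuous_subspaceT.
Qed.

Lemma int_abD (R : realType) (a b : R) (f g : R -> R) :
  continuous f -> continuous g ->
  int_ab a b (fun s => f s + g s) = int_ab a b f + int_ab a b g.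
Proof. by move=> cf cg; apply: RintegralD => //; exact: integrable_cont. Qed.

Lemma int_abZ (R : realType) (a b c : R) (f : R -> R) :
  continuous f -> int_ab a b (fun s => c * f s) = c * int_ab a b f.
Proof. by move=> cf; apply: RintegralZl => //; exact: integrable_cont. Qed.

Lemma int_ab_cst (R : realType) (a b c : R) : a <= b ->
  int_ab a b (fun _ => c) = c * (b - a).
Proof.
move=> ab; rewrite /int_ab Rintegral_cst //= lebesgue_measure_itv /=.
case: ltP => //=; rewrite ?lte_fin ?lee_fin => h.
by have -> : a = b by [apply/eqP; rewrite eq_le ab h]; rewrite subrr.
Qed.

Lemma int_ab_ext (R : realType) (a b : R) (f g : R -> R) :
  (forall s, f s = g s) -> int_ab a b f = int_ab a b g.
Proof. by move=> fg; congr int_ab; apply/funext. Qed.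

Lemma int_ab_le (R : realType) (a b : R) (f g : R -> R) :
  continuous f -> continuous g -> (forall s, a <= s <= b -> f s <= g s) ->
  int_ab a b f <= int_ab a b g.
Proof.
by move=> cf cg fg; apply: le_Rintegral => //; exact: integrable_cont.
Qed.

Lemma int_ab_dist (R : realType) (a b e : R) (f g : R -> R) : a <= b ->
  continuous f -> continuous g -> (forall s, a <= s <= b -> `|f s - g s| <= e) ->
  `|int_ab a b f - int_ab a b g| <= e * (b - a).
Proof.
move=> ab cf cg fg.
have cB (c : R) (h : R -> R) : continuous h -> continuous (fun s : R => h s + c).
  by move=> ch; apply: cont_add => //; exact: cont_cst.
have ce (c : R) : continuous (fun _ : R => c) by exact: cont_cst.
rewrite ler_distlC -int_ab_cst //; apply/andP; split.
  rewrite lerBlDr -int_abD //.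
  apply: int_ab_le => //; first exact: cB.
  by move=> s /fg; rewrite ler_norml => /andP[]; lra.
rewrite -int_abD //; apply: int_ab_le => //; first exact: cB.
by move=> s /fg; rewrite ler_norml => /andP[]; lra.
Qed.

Lemma is_derive_continuous (R : realType) (f f' : R -> R) :
  (forall s : R, is_derive s (1:R) f (f' s)) -> continuous f.
Proof.
move=> df s; apply: differentiable_continuous; apply/derivable1_diffP.
by have [] := df s.
Qed.

Lemma int_ab_FTC (R : realType) (a b : R) (f F : R -> R) : a < b ->
  continuous f -> (forall s : R, is_derive s (1:R) F (f s)) ->
  int_ab a b f = F b - F a.
Proof.
move=> ab cf dF; have cF := is_derive_continuous dF.
rewrite /int_ab /Rintegral (@continuous_FTC2 _ f F) //.
- exact: continuous_subspaceT.
- split=> [s _| |]; first by have [] := dF s.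
    by apply: cvg_at_right_filter; exact: cF.
  by apply: cvg_at_left_filter; exact: cF.
- by move=> s _; rewrite derive1E; have [] := dF s.
Qed.

Lemma derive_cst_zero (R : realType) (f : R -> R) :
  (forall s : R, is_derive s (1:R) f 0) -> forall x y, f x = f y.
Proof. by move=> df x y; exact: is_derive_0_is_cst. Qed.

(* Each difference quotient is a value of [D] by the mean value theorem, so
   uniform continuity of [D] suffices to pass to the limit. *)
Lemma is_derive_int_ab (R : realType) (a b : R) (k D : R -> R -> R) (y : R) :
  a <= b ->
  (forall z s : R, is_derive z (1:R) (k ^~ s) (D z s)) ->
  (forall z, continuous (k z)) -> continuous (D y) ->
  (forall e, 0 < e -> exists2 r, 0 < r &
     forall z s, a <= s <= b -> `|z - y| <= r -> `|D z s - D y s| <= e) ->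
  is_derive y (1:R) (fun z => int_ab a b (k z)) (int_ab a b (D y)).
Proof.
move=> ab dk ck cD uD.
suff H : (fun h => h^-1 *: (((fun z => int_ab a b (k z)) \o shift y) (h *: 1)
     - int_ab a b (k y))) @ 0^' --> int_ab a b (D y).
  apply: DeriveDef; first by apply: cvgP H.
  by rewrite /derive; apply: cvg_lim.
apply/cvgrPdist_le => e e0.
(* The added 1 keeps the denominator positive when [a = b]. *)
have e1 : 0 < e / (b - a + 1) by apply: divr_gt0 => //; lra.
have [r r0 hr] := uD _ e1.
have hball : \forall h \near (0:R)^', `|h| <= r.
  exact: dnbhs0_le.
have hn0 : \forall h \near (0:R)^', h != 0.
  exact: nbhs_dnbhs_neq.
near=> h.
have hr' : `|h| <= r by near: h.
have h0 : h != 0 by near: h.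
have -> : ((fun z => int_ab a b (k z)) \o shift y) (h *: 1) = int_ab a b (k (h + y)).
  by rewrite /= /GRing.scale /= mulr1.
have c2 : continuous (fun s => h^-1 * (k (h + y) s - k y s)).
  by apply: cont_mul; [exact: cont_cst|apply: cont_sub; exact: ck].
have -> : h^-1 *: (int_ab a b (k (h + y)) - int_ab a b (k y)) =
   int_ab a b (fun s => h^-1 * (k (h + y) s - k y s)).
  rewrite int_abZ; last by apply: cont_sub; exact: ck.
  rewrite /GRing.scale /=; congr (_ * _); rewrite int_abD //; last first.
    by move=> s; apply: (@continuousN _ _ _ (k y)); exact: ck.
  congr (_ + _); rewrite -mulN1r -int_abZ //.
  by apply: int_ab_ext => s; rewrite mulN1r.
apply: le_trans (_ : e / (b - a + 1) * (b - a) <= e); last first.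
  rewrite mulrAC ler_pdivrMr; last by lra.
  by rewrite ler_wpM2l ?ltW //; lra.
apply: int_ab_dist => // s sab.
have ckz : continuous (k ^~ s) by apply: (@is_derive_continuous _ _ (D ^~ s)).
have [c cr ->] : exists2 c, `|c - y| <= r & h^-1 * (k (h + y) s - k y s) = D c s.
  case: (ltrgt0P h) h0 => // hp _.
    have lt : y < h + y by lra.
    have [c cin e'] := MVT lt (fun z _ => dk z s) (continuous_subspaceT ckz).
    exists c.
      move: cin; rewrite in_itv /= => /andP[]; move: hr'; rewrite !ler_norml.
      by move=> /andP[]; lra.
    by rewrite e' addrK mulrC mulfK // gt_eqF.
  have lt : h + y < y by lra.
  have [c cin e'] := MVT lt (fun z _ => dk z s) (continuous_subspaceT ckz).
  exists c.
    move: cin; rewrite in_itv /= => /andP[]; move: hr'; rewrite !ler_norml.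
    by move=> /andP[]; lra.
  have hn : h != 0 by rewrite lt_eqF.
  by rewrite -opprB e'; field.
by rewrite distrC; exact: hr.
Unshelve. all: by end_near. Qed.

(** If [u2 > 0], the difference quotient of [u1] at 0 makes [u1] positive just to the right of 0,
    and the mean value theorem then makes [u] increase there, against the maximum. *)
Lemma second_order_max (R : realType) (u u1 : R -> R) (u2 : R) :
  (forall s : R, is_derive s (1:R) u (u1 s)) -> is_derive (0:R) (1:R) u1 u2 ->
  (forall s, u s <= u 0) -> u1 0 = 0 /\ u2 <= 0.
Proof.
move=> du du1 mx.
have d0 : is_derive (0:R) (1:R) u 0.
  have le : -1 <= 1 :> R by lra.
  have in01 : (0 : R) \in `]-1, 1[ by rewrite in_itv /=; apply/andP; split; lra.
  by apply: (derive1_at_max le _ in01) => t _; [have [] := du t|exact: mx].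
have u10 : u1 0 = 0.
  by have [_ <-] := du 0; have [_ ->] := d0.
split=> //; rewrite leNgt; apply/negP => u20.
have Hl : (fun h => h^-1 *: ((u1 \o shift 0) (h *: 1) - u1 0)) @ 0^' --> u2.
  have [h1 <-] := du1; exact: h1.
have /cvgrPdist_lt/(_ u2 u20) := Hl.
move=> [r /= r0 hr].
have pos s : 0 < s < r -> 0 < u1 s.
  move=> /andP[s0 sr].
  have := hr s; rewrite /ball /= sub0r normrN gtr0_norm // => /(_ sr).
  rewrite gt_eqF // => /(_ isT).
  rewrite u10 subr0 /GRing.scale /= mulr1 addr0 ltr_norml => /andP[_ h].
  have : 0 < s^-1 * u1 s by lra.
  by rewrite pmulr_rgt0 // invr_gt0.
have cu := is_derive_continuous du.
have lt : 0 < r / 2 by lra.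
have [c cin e'] := MVT lt (fun z _ => du z) (continuous_subspaceT cu).
have : 0 < u1 c by apply: pos; move: cin; rewrite in_itv /= => /andP[]; lra.
move=> c0; have := mx (r / 2).
have : 0 < u1 c * (r / 2 - 0) by apply: mulr_gt0 => //; lra.
by rewrite -e'; lra.
Qed.

(** * Touching points and periodic functions *)

(** The two difference quotients are the same function, so one-variable calculus applies along
    lines. *)
Lemma is_derive_line (R : realType) (V : normedModType R) (f : V -> R) (x v : V)
    (s l : R) :
  is_derive (x + s *: v) v f l <-> is_derive s (1 : R) (fun r => f (x + r *: v)) l.
Proof.
have E : (fun h : R => h^-1 *: (((fun r => f (x + r *: v)) \o shift s) (h *: (1 : R))
           - f (x + s *: v))) =
         (fun h : R => h^-1 *: ((f \o shift (x + s *: v)) (h *: v) - f (x + s *: v))).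
  apply/funext => h /=; congr (_ *: (f _ - _)).
  by rewrite [h *: 1]mulr1 scalerDl addrCA addrA.
by split=> -[cv dv]; apply: DeriveDef;
  move: cv dv; rewrite /derivable /derive /= E.
Qed.

Lemma is_derive_line0 (R : realType) (V : normedModType R) (f : V -> R) (x v : V)
    (l : R) :
  is_derive x v f l <-> is_derive (0 : R) (1 : R) (fun r => f (x + r *: v)) l.
Proof. by have := is_derive_line f x v 0 l; rewrite scale0r addr0. Qed.

Lemma is_derive_addr (R : realType) (f : R -> R) (z s l : R) :
  is_derive (z + s) (1 : R) f l -> is_derive z (1 : R) (fun r => f (r + s)) l.
Proof.
have E : (fun h : R => h^-1 *: (((fun r => f (r + s)) \o shift z) (h *: (1 : R))
           - f (z + s))) =
         (fun h : R => h^-1 *: ((f \o shift (z + s)) (h *: (1 : R)) - f (z + s))).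
  by apply/funext => h /=; rewrite addrA.
by move=> -[cv dv]; apply: DeriveDef; move: cv dv; rewrite /derivable /derive /= E.
Qed.

Lemma touch_above (R : realType) (V : normedModType R) (f g f1 g1 : V -> R)
    (f2 g2 : R) (x v : V) :
  (forall y, is_derive y v f (f1 y)) -> (forall y, is_derive y v g (g1 y)) ->
  is_derive x v f1 f2 -> is_derive x v g1 g2 ->
  (forall y, f y - g y <= f x - g x) -> f1 x = g1 x /\ f2 <= g2.
Proof.
move=> df dg df1 dg1 mx.
pose u r := f (x + r *: v) - g (x + r *: v).
pose u1 r := f1 (x + r *: v) - g1 (x + r *: v).
have [] := @second_order_max R u u1 (f2 - g2).
- move=> s; have h1 := iffLR (is_derive_line f x v s _) (df _).
  have h2 := iffLR (is_derive_line g x v s _) (dg _).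
  exact: (is_deriveB h1 h2).
- have h1 := iffLR (is_derive_line0 f1 x v _) df1.
  have h2 := iffLR (is_derive_line0 g1 x v _) dg1.
  exact: (is_deriveB h1 h2).
- by move=> s; rewrite /u scale0r addr0.
rewrite /u1 scale0r addr0 => /eqP; rewrite subr_eq0 => /eqP -> h; split=> //.
by rewrite -subr_le0.
Qed.

Lemma max_derive_eq (R : realType) (f g f1 g1 : R -> R) (t : R) :
  (forall s : R, is_derive s (1 : R) f (f1 s)) ->
  (forall s : R, is_derive s (1 : R) g (g1 s)) ->
  (forall s, f s - g s <= f t - g t) -> f1 t = g1 t.
Proof.
move=> df dg mx.
have lt : t - 1 <= t + 1 by lra.
have int : t \in `]t - 1, t + 1[ by rewrite in_itv /=; apply/andP; split; lra.
have du s : is_derive s (1 : R) (fun s => f s - g s) (f1 s - g1 s).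
  exact: (is_deriveB (df s) (dg s)).
have d0 : is_derive t (1 : R) (fun s => f s - g s) 0.
  by apply: (derive1_at_max lt _ int) => s _; [have [] := du s|exact: mx].
by apply/eqP; rewrite -subr_eq0; have [_ <-] := du t; have [_ ->] := d0.
Qed.

Lemma cont_sum (R : realType) (U : topologicalType) (I : Type) (r : seq I)
    (P : pred I) (f : I -> U -> R) :
  (forall i, P i -> continuous (f i)) ->
  continuous (fun x => \sum_(i <- r | P i) f i x).
Proof.
move=> cf; elim: r => [|i r IH].
  by under eq_fun do rewrite big_nil; exact: cont_cst.
under eq_fun do rewrite big_cons.
by case: (boolP (P i)) => // Pi; apply: cont_add => //; exact: cf.
Qed.

Lemma periodicMz (V : zmodType) (W : Type) (g : V -> W) (v : V) :
  (forall x, g (x + v) = g x) -> forall x (n : int), g (x + v *~ n) = g x.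
Proof.
move=> gv; have gn x (n : nat) : g (x + v *+ n) = g x.
  by elim: n => [|n IH]; rewrite ?mulr0n ?addr0 // mulrSr addrA gv.
move=> x [n|n]; first exact: gn.
by rewrite NegzE mulrNz -[in RHS](subrK (v *+ n.+1) x) gn.
Qed.

Section Periodic.
Variables (R : realType) (d : nat) (T : R).
Implicit Types (k : R -> 'rV[R]_d -> R).

Definition ivec (n : 'I_d -> int) : 'rV[R]_d := \row_i (n i)%:~R.

Lemma xperiodic_ivec (W : 'rV[R]_d -> R) n x : xperiodic W -> W (x + ivec n) = W x.
Proof.
move=> Wp; rewrite [ivec n]row_sum_delta.
elim: (index_enum _) x => [|i r IH] x; first by rewrite big_nil addr0.
by rewrite big_cons addrA IH mxE scaler_int (periodicMz (Wp i)).
Qed.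

(** The shift rounds [x - a] to the nearest integer vector. A coordinate moves only if it is at
    distance at least 1/2 from that of [a], and it lands within 1/2, hence no farther away. *)
Lemma reduce_mod1 (a x : 'rV[R]_d) : exists n, forall i,
  `|(x + ivec n) 0 i - a 0 i| <= 1 / 2 /\
  `|(x + ivec n) 0 i - a 0 i| <= `|x 0 i - a 0 i|.
Proof.
exists (fun i => - Num.floor (x 0 i - a 0 i + 1 / 2)) => i; rewrite !mxE.
set z := x 0 i - a 0 i; rewrite rmorphN /= addrAC -/z.
have := floor_itv (z + 1 / 2); rewrite rmorphD /=.
set n := Num.floor _ => /andP[n1 n2].
split; first by rewrite ler_norml; apply/andP; split; lra.
have : n <= -1 \/ n = 0 \/ 1 <= n by lia.
rewrite -[n <= _](ler_int R) -[1 <= n](ler_int R) => -[h|[h|h]].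
- rewrite [leRHS]ler0_norm; last by lra.
  by rewrite ler_norml; apply/andP; split; lra.
- by rewrite h subr0.
- rewrite [leRHS]ger0_norm; last by lra.
  by rewrite ler_norml; apply/andP; split; lra.
Qed.

Definition pcont k := (forall t x, k (t + T) x = k t x) /\
  (forall t, xperiodic (k t)) /\ continuous (fun p : R * 'rV[R]_d => k p.1 p.2).

Lemma pcont_shift k (n0 : int) n t x : pcont k ->
  k (t + T *~ n0) (x + ivec n) = k t x.
Proof.
move=> [kt [kx _]]; rewrite xperiodic_ivec //.
by rewrite (@periodicMz _ _ (k ^~ x) T).
Qed.

Hypothesis T0 : 0 < T.

Lemma reduce_time t : exists n : int, 0 <= t + T *~ n <= T.
Proof.
exists (- Num.floor (t / T)); rewrite mulrNz -mulrzr.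
have := floor_itv (t / T); rewrite rmorphD /=.
set n := (Num.floor _)%:~R => /andP[].
rewrite ler_pdivlMr // ltr_pdivrMr // => h1 h2.
by apply/andP; split; lra.
Qed.

Definition cell (a : 'rV[R]_d) : set (R * 'rV[R]_d) :=
  `[0, T] `*` [set x : 'rV[R]_d | forall i, `[a 0 i - 1 / 2, a 0 i + 1 / 2]%classic (x 0 i)].

Lemma cell_compact a : compact (cell a).
Proof.
apply: compact_setX; first exact: segment_compact.
apply: (@rV_compact _ _ (fun i => `[a 0 i - 1 / 2, a 0 i + 1 / 2]%classic)) => i.
exact: segment_compact.
Qed.

Lemma reduce_cell a t x : exists (n0 : int) (n : 'I_d -> int),
  cell a (t + T *~ n0, x + ivec n) /\
  (forall i, `|(x + ivec n) 0 i - a 0 i| <= `|x 0 i - a 0 i|).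
Proof.
have [n0 h0] := reduce_time t; have [n hn] := reduce_mod1 a x.
exists n0, n; split; last by move=> i; have [] := hn i.
split=> /=; first by rewrite in_itv.
move=> i; have [+ _] := hn i; rewrite ler_norml in_itv /= => /andP[h1 h2].
by apply/andP; split; lra.
Qed.

Definition sqdist (a x : 'rV[R]_d) := \sum_i (x 0 i - a 0 i) ^+ 2.

(* The penalty is not periodic, but [reduce_cell] moves any point into a cell
   centred at [a] without increasing it. *)
Lemma pcont_max k a L : pcont k -> 0 <= L -> exists t x, forall t' x',
  k t' x' - L * sqdist a x' <= k t x - L * sqdist a x.
Proof.
move=> kp L0; have [_ [_ kc]] := kp.
pose f (p : R * 'rV[R]_d) := k p.1 p.2 - L * sqdist a p.2.
have cf : continuous f.
  apply: cont_sub => //; apply: cont_mul; first exact: cont_cst.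
  apply: cont_sum => i _; apply: cont_mul; (apply: cont_sub; last exact: cont_cst);
  by move=> p; apply: (@continuous_comp _ _ _ snd (fun M : 'rV[R]_d => M 0 i)) => /=;
     [exact: cvg_snd|exact: coord_continuous].
have ne : cell a !=set0.
  by have [n0 [n [h _]]] := reduce_cell a 0 0; exists (0 + T *~ n0, 0 + ivec n).
have [p _ pmax] := compact_EVT_max ne (@cell_compact a) (continuous_subspaceT cf).
exists p.1, p.2 => t x; have [n0 [n [h hn]]] := reduce_cell a t x.
apply: le_trans (pmax _ (mem_set h)); rewrite /f /= pcont_shift // lerB // ler_wpM2l //.
apply: ler_sum => i _; rewrite -[leLHS]real_normK ?num_real //.
by rewrite -[leRHS]real_normK ?num_real // lerXn2r // nnegrE.
Qed.

Lemma pcont_bounded k : pcont k -> exists2 B, 0 < B & forall t x, `|k t x| <= B.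
Proof.
move=> kp; have kp' : pcont (fun t x => `|k t x|).
  have [kt [kx kc]] := kp; split; first by move=> t x; rewrite kt.
  split; first by move=> t i x; rewrite kx.
  by move=> p; apply: cvg_norm; exact: kc.
have [t [x h]] := pcont_max 0 kp' (lexx 0).
exists (`|k t x| + 1); first by apply: ltr_wpDl => //.
by move=> t' x'; have := h t' x'; rewrite !mul0r !subr0; lra.
Qed.

(** Compactness of the cell constrains the first point only, the second being free near it; a common
    translation of both points by periods brings the first one into the cell. *)
Lemma pcont_unif k (e : R) : pcont k -> 0 < e -> exists2 r, 0 < r &
  forall t x t' x', `|t - t'| <= r -> `|x - x'| <= r -> `|k t x - k t' x'| <= e.
Proof.
move=> kp e0; have [_ [_ kc]] := kp.
have H : forall p, cell 0 p -> \forall p' \near p & r \near (0:R)^'+,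
  forall t' x', `|p'.1 - t'| <= r -> `|p'.2 - x'| <= r ->
     `|k p'.1 p'.2 - k t' x'| <= e.
  move=> p _.
  have e2 : 0 < e / 2 by lra.
  have /cvgrPdist_le/(_ _ e2) := kc p.
  move=> /nbhs_ballP[r /= r0 hr].
  have r2 : 0 < r / 2 by lra.
  exists (ball p (r / 2), [set s | 0 < s < r / 2]) => /=.
    split; first exact: nbhsx_ballx.
    exists (r / 2) => //= s; rewrite /ball /= sub0r normrN => h s0.
    by rewrite s0 (le_lt_trans (ler_norm _) h).
  move=> [p' s] /= [bp /andP[s0 sr]] t' x' ht hx.
  have h1 : ball p r p' by apply: le_ball bp; lra.
  have h2 : ball p r (t', x').
    rewrite [r]splitr; apply: (ball_triangle bp); split => /=.
      by rewrite /ball /=; lra.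
    by rewrite mx_norm_ball /ball_ /=; lra.
  have /= := hr _ h1; have /= := hr _ h2; rewrite !ler_norml => /andP[] a1 a2 /andP[] a3 a4.
  by apply/andP; split; lra.
have [r /= r0 hr] := iffLR (compact_near_coveringP _) (@cell_compact 0) R
  ((0 : R)^'+) _ (@at_right_proper_filter R 0) H.
exists (r / 2); first by lra.
move=> t x t' x' ht hx.
have [n0 [n [h hn]]] := reduce_cell 0 t x.
rewrite -(pcont_shift n0 n t x) // -(pcont_shift n0 n t' x') //.
have hb : ball_ Num.norm 0 r (r / 2).
  by rewrite /= sub0r normrN gtr0_norm; lra.
have r20 : 0 < r / 2 by lra.
apply: (hr (r / 2) hb r20 _ h) => /=.
  by rewrite opprD addrACA subrr addr0.
by rewrite opprD addrACA subrr addr0.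
Qed.

End Periodic.

(** * Time averages and the comparison principle *)

Section Averaging.
Variables (R : realType) (d : nat) (T : R).
Hypothesis T0 : 0 < T.
Implicit Types (k : R -> 'rV[R]_d -> R).

Lemma cont_time k (t : R) x : pcont T k -> continuous (fun s => k (t + s) x).
Proof.
move=> [_ [_ kc]] s.
have ct : continuous (fun s : R => t + s).
  by apply: cont_add; [exact: cont_cst|move=> r; exact: cvg_id].
apply: (@continuous2_cvg _ _ _ _ _ _ (fun s : R => t + s) (fun _ => x) k).
- exact: (kc (t + s, x)).
- exact: ct.
- exact: cvg_cst.
Qed.

Lemma cont_slice k x : pcont T k -> continuous (fun s => k s x).
Proof. by move=> /(cont_time (t := 0) (x := x)); under eq_fun do rewrite add0r. Qed.

(** Used with [w = 1], the integral over the period starting at [t], and with [w = id], for the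
    corrector; the bound [T + 1] assumed below fits both. Having [t] in the integrand and not in the
    bounds lets derivatives pass to [k]. *)
Definition wint (w : R -> R) k (t : R) (x : 'rV[R]_d) : R :=
  int_ab 0 T (fun s => w s * k (t + s) x).

Section Weight.
Variable w : R -> R.
Hypothesis cw : continuous w.
Hypothesis wT : forall s, 0 <= s <= T -> `|w s| <= T + 1.

Let cwk k t x : pcont T k -> continuous (fun s => w s * k (t + s) x).
Proof. by move=> kp; apply: cont_mul => //; exact: cont_time. Qed.

Let wunif k (e : R) : pcont T k -> 0 < e -> exists2 r, 0 < r &
  forall t x t' x' s, `|t - t'| <= r -> `|x - x'| <= r -> 0 <= s <= T ->
    `|w s * k (t + s) x - w s * k (t' + s) x'| <= e.
Proof.
move=> kp e0.
have Tp : 0 < T + 1 by rewrite addr_gt0.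
have e1 : 0 < e / (T + 1) by apply: divr_gt0.
have [r r0 hr] := pcont_unif T0 kp e1.
exists r => // t x t' x' s ht hx hs; rewrite -mulrBr normrM.
have -> : e = (T + 1) * (e / (T + 1)) by rewrite mulrC divfK // gt_eqF.
apply: ler_pM => //; first exact: wT.
by apply: hr => //; rewrite opprD addrACA subrr addr0.
Qed.

Lemma wint_pcont k : pcont T k -> pcont T (wint w k).
Proof.
move=> kp; have [kt [kx _]] := kp; split.
  by move=> t x; apply: int_ab_ext => s; rewrite addrAC kt.
split; first by move=> t i x; apply: int_ab_ext => s; rewrite kx.
move=> p; apply/cvgrPdist_le => e e0.
have e1 : 0 < e / T by apply: divr_gt0.
have [r r0 hr] := wunif kp e1.
apply: filterS (nbhsx_ballx p r r0) => q [] /=.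
rewrite mx_norm_ball /ball /= => h1 h2.
have -> : e = e / T * (T - 0) by rewrite subr0 divfK // gt_eqF.
apply: int_ab_dist; [exact: ltW|exact: cwk|exact: cwk|].
by move=> s hs; apply: hr => //; exact: ltW.
Qed.

Lemma wint_dx k k' (i : 'I_d) t x : pcont T k -> pcont T k' ->
  (forall t x, is_derive x (evec R i) (k t) (k' t x)) ->
  is_derive x (evec R i) (wint w k t) (wint w k' t x).
Proof.
move=> kp kp' dk; apply/is_derive_line0.
have := @is_derive_int_ab R 0 T (fun r s => w s * k (t + s) (x + r *: evec R i))
   (fun r s => w s * k' (t + s) (x + r *: evec R i)) 0 (ltW T0).
rewrite /= scale0r addr0; apply.
- move=> z s; have h := iffLR (is_derive_line _ _ _ _ _) (dk (t + s) (x + z *: evec R i)).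
  exact: (is_deriveZ (w s) h).
- by move=> z; exact: cwk.
- exact: cwk.
- move=> e e0; have [r r0 hr] := wunif kp' e0.
  exists (r / (`|evec R i| + 1)); first by apply: divr_gt0 => //; apply: ltr_wpDl.
  move=> z s hs; rewrite subr0 => hz; apply: hr => //.
    by rewrite subrr normr0 ltW.
  have n0 : 0 <= `|evec R i| by [].
  rewrite [x + _]addrC addrK normrZ; apply: le_trans (_ : `|z| * (`|evec R i| + 1) <= _).
    by apply: ler_wpM2l => //; lra.
  by rewrite -ler_pdivlMr //; lra.
Qed.

Lemma wint_dt0 k k' t x : pcont T k -> pcont T k' ->
  (forall t x, is_derive t (1 : R) (k ^~ x) (k' t x)) ->
  is_derive t (1 : R) (wint w k ^~ x) (wint w k' t x).
Proof.
move=> kp kp' dk.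
apply: (@is_derive_int_ab R 0 T (fun r s => w s * k (r + s) x)
   (fun r s => w s * k' (r + s) x) t (ltW T0)).
- move=> z s; have h := is_derive_addr (dk (z + s) x).
  exact: (is_deriveZ (w s) h).
- by move=> z; exact: cwk.
- exact: cwk.
- move=> e e0; have [r r0 hr] := wunif kp' e0.
  by exists r => // z s hs hz; apply: hr => //; rewrite subrr normr0 ltW.
Qed.

End Weight.

Let norm_cst1 (s : R) : 0 <= s <= T -> `|1 : R| <= T + 1.
Proof. by move=> _; rewrite normr1 lerDr ltW. Qed.

Let norm_id (s : R) : 0 <= s <= T -> `|s| <= T + 1.
Proof. by move=> /andP[s0 sT]; rewrite ger0_norm // (le_trans sT) // lerDl. Qed.

Let cont_id : continuous (fun s : R => s).
Proof. by move=> s; exact: cvg_id. Qed.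

Definition mean k x := T^-1 * int_ab 0 T (fun s => k s x).

(* Adding [corrector k] to a test function replaces [k] by its time mean, see
   [corrector_dt]. Averaging over translates in [t] makes it periodic, unlike
   the primitive of [mean k x - k t x] starting at [0]. *)
Definition corrector k t x := - T^-1 * wint id k t x.

Let shift_dt k k' t x : (forall t x, is_derive t (1 : R) (k ^~ x) (k' t x)) ->
  forall r : R, is_derive r (1 : R) (fun r => k (t + r) x) (k' (t + r) x).
Proof.
move=> dk r; under eq_fun do rewrite addrC.
by apply: (is_derive_addr (f := k ^~ x)); rewrite addrC; exact: dk.
Qed.

(** The derivative in [t] is the integral of [k'] over a period, that is
    [k (t + T) x - k t x = 0]. *)
Lemma int_period k k' x t : pcont T k -> pcont T k' ->
  (forall t x, is_derive t (1 : R) (k ^~ x) (k' t x)) ->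
  int_ab 0 T (fun s => k (t + s) x) = int_ab 0 T (fun s => k s x).
Proof.
move=> kp kp' dk.
have E k1 s : wint (fun => 1) k1 s x = int_ab 0 T (fun r => k1 (s + r) x).
  by apply: int_ab_ext => r; rewrite mul1r.
have -> : int_ab 0 T (fun s => k s x) = int_ab 0 T (fun s => k (0 + s) x).
  by apply: int_ab_ext => s; rewrite add0r.
rewrite -!E; apply: (derive_cst_zero (f := wint (fun=> 1) k ^~ x)) => s.
have := wint_dt0 (@cont_cst _ _ 1) norm_cst1 s x kp kp' dk.
have ck' := cont_time (t := s) (x := x) kp'.
by rewrite E (int_ab_FTC T0 ck' (shift_dt s x dk));
  have [kt _] := kp; rewrite kt addr0 subrr.
Qed.

Lemma mean_unif k e : pcont T k -> 0 < e -> exists2 r, 0 < r &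
  forall x x', `|x - x'| <= r -> `|mean k x - mean k x'| <= e.
Proof.
move=> kp e0; have [r r0 hr] := pcont_unif T0 kp e0.
exists r => // x x' hx; rewrite -mulrBr normrM gtr0_norm ?invr_gt0 //.
rewrite mulrC ler_pdivrMr // -[X in e * X]subr0.
apply: int_ab_dist; [exact: ltW|exact: cont_slice|exact: cont_slice|].
by move=> s _; apply: hr => //; rewrite subrr normr0 ltW.
Qed.

Lemma corrector_pcont k : pcont T k -> pcont T (corrector k).
Proof.
move=> kp; have [wt [wx wc]] := wint_pcont cont_id norm_id kp; split.
  by move=> t x; rewrite /corrector wt.
split; first by move=> t i x; rewrite /corrector wx.
by apply: cont_mul; [exact: cont_cst|exact: wc].
Qed.

Lemma corrector_dx k k' (i : 'I_d) t x : pcont T k -> pcont T k' ->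
  (forall t x, is_derive x (evec R i) (k t) (k' t x)) ->
  is_derive x (evec R i) (corrector k t) (corrector k' t x).
Proof.
move=> kp kp' dk.
exact: (is_deriveZ (- T^-1) (wint_dx cont_id norm_id t x kp kp' dk)).
Qed.

(** Integration by parts: over a period, the integral of [s * k' (t + s) x] is [T * k (t + T) x]
    minus the integral of [k], hence [T * (k t x - mean k x)] by periodicity. This is where the
    factor [- T^-1] comes from. *)
Lemma corrector_dt k k' t x : pcont T k -> pcont T k' ->
  (forall t x, is_derive t (1 : R) (k ^~ x) (k' t x)) ->
  is_derive t (1 : R) (corrector k ^~ x) (mean k x - k t x).
Proof.
move=> kp kp' dk.
have := is_deriveZ (- T^-1) (wint_dt0 cont_id norm_id t x kp kp' dk).
have -> : - T^-1 *: wint id k' t x = mean k x - k t x; last by [].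
have ck := cont_time (t := t) (x := x) kp; have ck' := cont_time (t := t) (x := x) kp'.
have : int_ab 0 T (fun s => s * k' (t + s) x + k (t + s) x) = T * k (t + T) x.
  have dk1 (r : R) : is_derive r (1 : R) (fun r => r * k (t + r) x)
      (r * k' (t + r) x + k (t + r) x).
    have := is_deriveM (is_derive_id r (1 : R)) (shift_dt t x dk r).
    by rewrite /GRing.scale /= mulr1.
  rewrite (int_ab_FTC T0 _ dk1) ?mul0r ?subr0 //.
  by apply: cont_add => //; apply: cont_mul.
rewrite int_abD //; last exact: cont_mul.
rewrite (int_period x t kp kp' dk); have [-> _] := kp.
rewrite /mean /wint /GRing.scale /= => h.
have Tn : T != 0 by rewrite gt_eqF.
have -> : int_ab 0 T (fun s => s * k' (t + s) x) =
          T * k t x - int_ab 0 T (fun s => k s x) by rewrite -h addrK.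
by field.
Qed.

End Averaging.

Lemma is_derive_bigsum (R : realType) (V : normedModType R) (I : Type) (r : seq I)
    (v x : V) (f : I -> V -> R) (f' : I -> R) :
  (forall i, is_derive x v (f i) (f' i)) ->
  is_derive x v (fun y => \sum_(i <- r) f i y) (\sum_(i <- r) f' i).
Proof.
move=> df; elim: r => [|a s IH].
  by under eq_fun do rewrite big_nil; rewrite big_nil; exact: is_derive_cst.
under eq_fun do rewrite big_cons; rewrite big_cons.
exact: (is_deriveD (df a) IH).
Qed.

Section Comparison.
Variables (R : realType) (d : nat) (T : R).
Implicit Types (phi psi psit : R -> 'rV[R]_d -> R).

(* [psit], [g i], [h i] stand for the time derivative and the first and second
   derivatives in the direction [i]; mixed second derivatives play no role. *)
Definition jet psi psit (g h : 'I_d -> R -> 'rV[R]_d -> R) : Prop :=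
  (forall t x, is_derive t (1 : R) (psi ^~ x) (psit t x)) /\
  (forall i t x, is_derive x (evec R i) (psi t) (g i t x)) /\
  (forall i t x, is_derive x (evec R i) (g i t) (h i t x)).

Lemma jet_add psi psit g h psi' psit' g' h' :
  jet psi psit g h -> jet psi' psit' g' h' ->
  jet (fun t x => psi t x + psi' t x) (fun t x => psit t x + psit' t x)
      (fun i t x => g i t x + g' i t x) (fun i t x => h i t x + h' i t x).
Proof.
move=> [a1 [b1 c1]] [a2 [b2 c2]]; split; first by move=> t x; exact: (is_deriveD (a1 t x) (a2 t x)).
split; first by move=> i t x; exact: (is_deriveD (b1 i t x) (b2 i t x)).
by move=> i t x; exact: (is_deriveD (c1 i t x) (c2 i t x)).
Qed.

Lemma jet_scale c psi psit g h : jet psi psit g h ->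
  jet (fun t x => c * psi t x) (fun t x => c * psit t x)
      (fun i t x => c * g i t x) (fun i t x => c * h i t x).
Proof.
move=> [a1 [b1 c1]]; split; first by move=> t x; exact: (is_deriveZ c (a1 t x)).
split; first by move=> i t x; exact: (is_deriveZ c (b1 i t x)).
by move=> i t x; exact: (is_deriveZ c (c1 i t x)).
Qed.

Lemma jet_sum (I : Type) (r : seq I) (psi psit : I -> R -> 'rV[R]_d -> R) g h :
  (forall i : I, jet (psi i) (psit i) (g i) (h i)) ->
  jet (fun t x => \sum_(i <- r) psi i t x) (fun t x => \sum_(i <- r) psit i t x)
      (fun k t x => \sum_(i <- r) g i k t x) (fun k t x => \sum_(i <- r) h i k t x).
Proof.
move=> J; split=> [t x|]; first by apply: is_derive_bigsum => i; have [+ _] := J i; exact.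
split=> k t x; first by apply: is_derive_bigsum => i; have [_ [+ _]] := J i; exact.
by apply: is_derive_bigsum => i; have [_ [_ +]] := J i; exact.
Qed.

Lemma derive_periodic (V : normedModType R) (g : V -> R) (v w : V) :
  (forall x, g (x + w) = g x) -> forall x, 'D_v g (x + w) = 'D_v g x.
Proof.
move=> gp x; rewrite /derive.
rewrite (_ : (fun h : R => h^-1 *: ((g \o shift (x + w)) (h *: v) - g (x + w))) =
  (fun h : R => h^-1 *: ((g \o shift x) (h *: v) - g x))) //.
by apply/funext => h /=; rewrite addrA !gp.
Qed.

Lemma xperiodic_pdx (g : 'rV[R]_d -> R) i : xperiodic g -> xperiodic (pdx i g).
Proof. by move=> gp j x; apply: derive_periodic; exact: gp. Qed.

Lemma C12per_jet phi : C12per T phi ->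
  jet phi (pdt phi) (fun i t => pdx i (phi t)) (fun i t => pdx i (pdx i (phi t))).
Proof.
move=> [_ [_ [_ [dt [_ [dx [_ [dxx _]]]]]]]]; split=> [t x|].
  by apply: DeriveDef => //; exact: dt.
by split=> i t x; apply: DeriveDef.
Qed.

Lemma C12per_pcont phi : C12per T phi -> [/\ pcont T phi, pcont T (pdt phi),
  (forall i, pcont T (fun t => pdx i (phi t))) &
  (forall i, pcont T (fun t => pdx i (pdx i (phi t))))].
Proof.
move=> [pt [px [pc [_ [ptc [_ [pxc [_ pxxc]]]]]]]].
have pT t : phi (t + T) = phi t by apply/funext => x; exact: pt.
split.
- by split; [exact: pt|split; [exact: px|exact: pc]].
- split; first by move=> t x; apply: (derive_periodic (g := phi ^~ x)) => s; exact: pt.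
  split; last exact: ptc.
  by move=> t i x; rewrite /pdt; congr ('D_1 _ t); apply/funext => s; exact: px.
- move=> i; split; first by move=> t x; rewrite pT.
  by split; [move=> t; exact: xperiodic_pdx|exact: pxc].
- move=> i; split; first by move=> t x; rewrite pT.
  split; last exact: pxxc.
  by move=> t; exact: (xperiodic_pdx i (xperiodic_pdx i (px t))).
Qed.

Variables (H : 'rV[R]_d -> R) (m : R -> 'rV[R]_d -> R) (mu lam : R).
Variable phi : R -> 'rV[R]_d -> R.
Hypothesis mu0 : 0 <= mu.
Hypothesis phiC : C12per T phi.
Hypothesis eqn : forall t x,
  lam + pdt phi t x + mu * (- lap (phi t) x + H (grad (phi t) x)) = - m t x.

(** This is F of the overview, with the derivatives of the test function passed as data, in the form
    in which [jet] relates them. *)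
Definition pde_op psit (g h : 'I_d -> R -> 'rV[R]_d -> R) t x :=
  m t x + psit t x + mu * (- (\sum_i h i t x) + H (\row_i g i t x)).

(** At the touching point [phi] and [psi] have the same time derivative and gradient, while each
    pure second derivative of [phi] is at most that of [psi]; the sign of [mu] turns this into an
    inequality between the two operators. *)
Lemma eigen_ge psi psit g h t x : jet psi psit g h ->
  (forall t' x', phi t' x' - psi t' x' <= phi t x - psi t x) ->
  pde_op psit g h t x <= - lam.
Proof.
move=> [jt [jx jxx]] mx; have [ft [fx fxx]] := C12per_jet phiC.
have et : pdt phi t x = psit t x.
  apply: (max_derive_eq (f := phi ^~ x) (f1 := pdt phi ^~ x)
           (g := psi ^~ x) (g1 := psit ^~ x)) => // s; exact: mx.
have tch i := touch_above (fx i t) (jx i t) (fxx i t x) (jxx i t x) (mx t).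
have eg : grad (phi t) x = \row_i g i t x.
  by apply/rowP => i; rewrite !mxE; have [] := tch i.
have el : lap (phi t) x <= \sum_i h i t x.
  by apply: ler_sum => i _; have [] := tch i.
rewrite /pde_op -et -eg; have := eqn t x.
have : mu * lap (phi t) x <= mu * (\sum_i h i t x) by apply: ler_wpM2l.
by rewrite !mulrDr !mulrN; lra.
Qed.

Lemma eigen_le psi psit g h t x : jet psi psit g h ->
  (forall t' x', psi t' x' - phi t' x' <= psi t x - phi t x) ->
  - lam <= pde_op psit g h t x.
Proof.
move=> [jt [jx jxx]] mx; have [ft [fx fxx]] := C12per_jet phiC.
have et : psit t x = pdt phi t x.
  apply: (max_derive_eq (g := phi ^~ x) (g1 := pdt phi ^~ x)
           (f := psi ^~ x) (f1 := psit ^~ x)) => // s; exact: mx.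
have tch i := touch_above (jx i t) (fx i t) (jxx i t x) (fxx i t x) (mx t).
have eg : \row_i g i t x = grad (phi t) x.
  by apply/rowP => i; rewrite !mxE; have [] := tch i.
have el : \sum_i h i t x <= lap (phi t) x.
  by apply: ler_sum => i _; have [] := tch i.
rewrite /pde_op et eg; have := eqn t x.
have : mu * (\sum_i h i t x) <= mu * lap (phi t) x by apply: ler_wpM2l.
by rewrite !mulrDr !mulrN; lra.
Qed.

End Comparison.

(** * The Hamiltonian and test functions *)

Lemma int_ab_sum (R : realType) (T : R) (I : Type) (r : seq I) (f : I -> R -> R) :
  0 <= T -> (forall i, continuous (f i)) ->
  int_ab 0 T (fun s => \sum_(i <- r) f i s) = \sum_(i <- r) int_ab 0 T (f i).
Proof.
move=> T0 cf; elim: r => [|a r IH].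
  under eq_fun do rewrite big_nil.
  by rewrite big_nil int_ab_cst // mul0r.
rewrite big_cons -IH -int_abD //; last by apply: cont_sum.
by apply: int_ab_ext => s; rewrite big_cons.
Qed.

Lemma coord_norm_le (R : realType) d (p : 'rV[R]_d) i : `|p 0 i| <= `|p|.
Proof.
rewrite [leRHS]/Num.norm /= mx_normrE; apply/bigmax_geP; right => /=.
by exists (0, i).
Qed.

Lemma norm_coord_le (R : realType) d (p : 'rV[R]_d) B : 0 <= B ->
  (forall i, `|p 0 i| <= B) -> `|p| <= B.
Proof.
move=> B0 h; rewrite [leLHS]/Num.norm /= mx_normrE; apply/bigmax_leP; split=> //.
by move=> [i j] _ /=; rewrite ord1.
Qed.

Lemma box_compact (R : realType) d (B : R) :
  compact [set p : 'rV[R]_d | forall i, `[- B, B]%classic (p 0 i)].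
Proof. by apply: (@rV_compact _ _ (fun=> `[- B, B]%classic)) => i; exact: segment_compact. Qed.

Lemma box_nonempty (R : realType) d (B : R) : 0 <= B ->
  [set p : 'rV[R]_d | forall i, `[- B, B]%classic (p 0 i)] !=set0.
Proof.
move=> B0; exists 0 => i; rewrite mxE /= in_itv /=.
by apply/andP; split; rewrite ?oppr_le0.
Qed.

Lemma powR_small (R : realType) (s e : R) : 0 < s -> 0 < e ->
  exists2 r, 0 < r & forall a, 0 < a -> a <= r -> a `^ s <= e.
Proof.
move=> s0 e0; have /cvgrPdist_le/(_ _ e0) := @powR_cvg0 R s s0.
move=> [r /= r0 hr]; exists (r / 2); first by lra.
move=> a a0 ar; have := hr a; rewrite /ball_ /= sub0r normrN gtr0_norm //.
move=> /(_ _ a0); rewrite sub0r normrN ger0_norm ?powR_ge0 //; apply.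
by lra.
Qed.

Section Hamiltonian.
Variables (R : realType) (d : nat) (H : 'rV[R]_d -> R).
Hypothesis HH : assumptionsH H.

Lemma H_cont : continuous H.
Proof. by have [[]] := HH. Qed.

Lemma H_ge0 p : 0 <= H p.
Proof.
have [_ [H0 [Hp _]]] := HH.
by have [->|/Hp/ltW//] := eqVneq p 0; rewrite H0.
Qed.

Lemma H_superlinear : exists beta : R, [/\ 0 < beta, beta < 1 &
  forall a p, 0 < a -> a < 1 -> H (a `^ beta *: p) <= a * H p].
Proof. by have [_ [_ [_ [_ [_ h]]]]] := HH. Qed.

Lemma H_bounded (B : R) : 0 <= B -> exists2 C, 0 < C &
  forall p : 'rV[R]_d, (forall i, `|p 0 i| <= B) -> H p <= C.
Proof.
move=> B0; have [p _ pmax] := compact_EVT_max (@box_nonempty R d _ B0)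
  (@box_compact R d B) (continuous_subspaceT H_cont).
exists (H p + 1) => [|q hq]; first by rewrite ltr_wpDl // H_ge0.
apply: le_trans (pmax q _) _; last by rewrite lerDl.
by rewrite inE => i; have := hq i; rewrite /= in_itv /= ler_norml.
Qed.

(* On the unit box [H p + (1 - |p|)] is positive, so it has a positive minimum,
   which bounds [H] on the unit sphere; rays are handled by superlinearity. *)
Lemma H_lower : exists2 c, 0 < c & forall p : 'rV[R]_d, 1 <= `|p| -> c <= H p.
Proof.
have [beta [b0 b1 hb]] := H_superlinear.
have cG : continuous (fun p : 'rV[R]_d => H p + (1 - `|p|)).
  apply: cont_add; first exact: H_cont.
  by apply: cont_sub; [exact: cont_cst|move=> p; exact: norm_continuous].
have [p pin pmin] := compact_EVT_min (@box_nonempty R d 1 ler01)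
  (@box_compact R d 1) (continuous_subspaceT cG).
exists (H p + (1 - `|p|)).
  have p1 : `|p| <= 1.
    apply: norm_coord_le => // i; move: pin; rewrite inE => /(_ i) /=.
    by rewrite in_itv /= ler_norml.
  have [_ [H0 [Hp _]]] := HH.
  have [p0|/Hp hp] := eqVneq p 0; last by lra.
  by rewrite p0 H0 normr0; lra.
have sph q : `|q| = 1 -> H p + (1 - `|p|) <= H q.
  move=> q1; have : H p + (1 - `|p|) <= H q + (1 - `|q|); last by rewrite q1 subrr addr0.
  apply: pmin; rewrite inE => i /=; rewrite in_itv /= -ler_norml -q1.
  exact: coord_norm_le.
move=> q; rewrite le_eqVlt => /orP[/eqP/esym/sph //|q1].
have q0 : 0 < `|q| by apply: lt_trans q1.
have bV : 0 < beta^-1 by rewrite invr_gt0.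
have r1 : 1 < `|q| `^ beta^-1.
  by have := gt0_ltr_powR bV _ _ q1; rewrite powR1; apply; rewrite nnegrE ltW.
(* With [a = |q| ^ (- 1 / beta)] the vector [a ^ beta *: q] has norm 1, and
   [H q >= a * H q >= H (a ^ beta *: q)]. *)
have a0 : 0 < (`|q| `^ beta^-1)^-1 by rewrite invr_gt0 (lt_trans _ r1).
have a1 : (`|q| `^ beta^-1)^-1 < 1 by rewrite invf_lt1 // (lt_trans _ r1).
have ab : (`|q| `^ beta^-1)^-1 `^ beta = `|q|^-1.
  rewrite -powRN -powRrM mulNr mulVf ?gt_eqF // powR_inv1 //.
have := hb _ q a0 a1; rewrite ab => h.
apply: le_trans (le_trans h _); last by rewrite ler_piMl ?H_ge0 // ltW.
by apply: sph; rewrite normrZ gtr0_norm ?invr_gt0 // mulVf // gt_eqF.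
Qed.

End Hamiltonian.

Section TestFunctions.
Variables (R : realType) (d : nat) (T : R).

Lemma is_derive_coord (x v : 'rV[R]_d) j :
  is_derive x v (fun y : 'rV[R]_d => y 0 j) (v 0 j).
Proof.
apply/is_derive_line0.
under eq_fun do rewrite !mxE.
have := is_deriveD (is_derive_cst (x 0 j) (0 : R) (1 : R))
  (is_deriveM (is_derive_id (0 : R) (1 : R)) (is_derive_cst (v 0 j) (0 : R) (1 : R))).
by rewrite /GRing.scale /= mul0r mulr1 !add0r.
Qed.

Lemma jet_sqdist (a : 'rV[R]_d) :
  jet (fun _ x => sqdist a x) (fun _ _ => 0) (fun i _ x => 2 * (x 0 i - a 0 i))
      (fun _ _ _ => 2).
Proof.
have dB (x v : 'rV[R]_d) i :
    is_derive x v (fun y : 'rV[R]_d => y 0 i - a 0 i) (v 0 i).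
  have := is_deriveB (is_derive_coord x v i) (is_derive_cst (a 0 i) x v).
  by rewrite subr0.
split; first by move=> t x; exact: is_derive_cst.
split=> i t x.
- have := is_derive_bigsum (index_enum 'I_d)
    (fun j => is_deriveM (dB x (evec R i) j) (dB x (evec R i) j)).
  rewrite (bigD1 i) //= big1 => [|j ji]; last first.
    by rewrite !mxE eqxx (negbTE ji) /= !scaler0 addr0.
  rewrite !mxE !eqxx /= addr0 /GRing.scale /= !mulr1 -mulr2n -[(_ - _) *+ 2]mulr_natl; exact.
- have := is_deriveZ 2 (dB x (evec R i) i).
  by rewrite !mxE !eqxx /= /GRing.scale /= mulr1.
Qed.

Lemma jet_time (al al' : R -> R) : (forall t : R, is_derive t (1 : R) al (al' t)) ->
  jet (fun t (_ : 'rV[R]_d) => al t) (fun t _ => al' t) (fun _ _ _ => 0) (fun _ _ _ => 0).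
Proof. by move=> da; split=> [t x|]; [exact: da|split=> i t x; exact: is_derive_cst]. Qed.

Lemma pcont_sub k k' : @pcont R d T k -> pcont T k' -> pcont T (fun t x => k t x - k' t x).
Proof.
move=> [a1 [b1 c1]] [a2 [b2 c2]]; split; first by move=> t x; rewrite a1 a2.
split; first by move=> t i x; rewrite b1 b2.
exact: cont_sub.
Qed.

Lemma pcont_at (k : R -> 'rV[R]_d -> R) z : pcont T k -> pcont T (fun t (_ : 'rV[R]_d) => k t z).
Proof.
move=> kp; have [kt [kx kc]] := kp; split; first by move=> t x; rewrite kt.
split=> //; have ck := cont_slice (x := z) kp.
by move=> p; apply: (@continuous_comp _ _ _ fst (fun s => k s z)); [exact: cvg_fst|exact: ck].
Qed.

Lemma pcont_scale c (k : R -> 'rV[R]_d -> R) : pcont T k -> pcont T (fun t x => c * k t x).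
Proof.
move=> [kt [kx kc]]; split; first by move=> t x; rewrite kt.
split; first by move=> t i x; rewrite kx.
by apply: cont_mul => //; exact: cont_cst.
Qed.

Lemma pcont_add (k k' : R -> 'rV[R]_d -> R) : pcont T k -> pcont T k' ->
  pcont T (fun t x => k t x + k' t x).
Proof.
move=> [a1 [b1 c1]] [a2 [b2 c2]]; split; first by move=> t x; rewrite a1 a2.
split; first by move=> t i x; rewrite b1 b2.
exact: cont_add.
Qed.

Lemma pcont_sum (I : Type) (r : seq I) (k : I -> R -> 'rV[R]_d -> R) :
  (forall i, pcont T (k i)) -> pcont T (fun t x => \sum_(i <- r) k i t x).
Proof.
move=> kp; split.
  by move=> t x; apply: eq_bigr => i _; have [-> _] := kp i.
split=> [t i x|]; first by apply: eq_bigr => j _; have [_ [kx _]] := kp j; rewrite kx.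
by apply: cont_sum => i _; have [_ [_ kc]] := kp i.
Qed.

Lemma bounded_fam (I : finType) (F : I -> R -> 'rV[R]_d -> R) :
  (forall w, exists B, forall t x, `|F w t x| <= B) ->
  exists2 B, 0 < B & forall w t x, `|F w t x| <= B.
Proof.
move=> /choice[B hB].
have B0 w : 0 <= B w by apply: le_trans (hB w 0 0).
exists (1 + \sum_w B w); first by apply: ltr_pwDl => //; apply: sumr_ge0.
move=> w t x; apply: (le_trans (hB w t x)).
by rewrite (bigD1 w) //= addrCA lerDl addr_ge0 // sumr_ge0.
Qed.

Lemma pcont_bounded_fam (I : finType) (k : I -> R -> 'rV[R]_d -> R) : 0 < T ->
  (forall i, pcont T (k i)) ->
  exists2 B, 0 < B & forall i t x, `|k i t x| <= B.
Proof.
by move=> T0 kp; apply: bounded_fam => i; have [B _ hB] := pcont_bounded T0 (kp i); exists B.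
Qed.

End TestFunctions.

(** * Small diffusion *)

(** Choice of the penalty. With [a = K * mu] and [L = a ^ (- beta) / delta], the quantity
    [a ^ beta * (2 * L * delta)] equals 2, which leaves at least 1 after a loss [a ^ beta * C <= 1],
    while [mu * L] is of order [a ^ (1 - beta)]. In use, [C] bounds the corrector terms, [D] is the
    Laplacian of [sqdist] and [delta] is a radius around [x0]. *)
Lemma dominate_drift (R : realType) (beta K C delta eta : R) (D : R) :
  0 < beta -> beta < 1 -> 0 < K -> 0 <= C -> 0 < delta -> 0 < eta -> 0 <= D ->
  exists2 r, 0 < r & forall mu, 0 < mu -> mu <= r -> exists L,
    [/\ 0 < L, K * mu < 1, 1 <= (K * mu) `^ beta * (2 * L * delta - C),
        mu * C <= eta & mu * (D * L) <= eta].
Proof.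
move=> b0 b1 K0 C0 d0 eta0 D0.
have Cp : 0 < C + 1 by lra.
have b1' : 0 < 1 - beta by lra.
have Dp : 0 < D / (K * delta) + 1.
  by rewrite ltr_wpDl // divr_ge0 // ltW // mulr_gt0.
have e1 : 0 < (C + 1)^-1 by rewrite invr_gt0.
have e2 : 0 < eta / (D / (K * delta) + 1) by apply: divr_gt0.
have [r1 r10 h1] := powR_small b0 e1.
have [r2 r20 h2] := powR_small b1' e2.
have K2 : 0 < (2 * K)^-1 by rewrite invr_gt0 mulr_gt0.
(* With [a = K * mu], the four entries give [a ^ beta <= 1 / (C + 1)], the bound on
   [a ^ (1 - beta)], [a <= 1 / 2] and [mu * C <= eta]. The added ones keep denominators positive
   when [C] or [D] is 0. *)
exists (Num.min (Num.min (r1 / K) (r2 / K)) (Num.min (2 * K)^-1 (eta / (C + 1)))).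
  by rewrite !lt_min K2 !divr_gt0.
move=> mu mu0; rewrite !le_min !ler_pdivlMr // => /andP[/andP[m1 m2] /andP[m3 m4]].
have a0 : 0 < K * mu by apply: mulr_gt0.
have a1 : K * mu < 1.
  have : (2 * K) * mu <= 1.
    have K2' : 0 < 2 * K by apply: mulr_gt0.
    by rewrite mulrC -ler_pdivlMr // mul1r.
  by rewrite -mulrA; lra.
have p0 : 0 < (K * mu) `^ beta by exact: powR_gt0.
exists (((K * mu) `^ beta)^-1 / delta); split=> //.
- by rewrite divr_gt0 // invr_gt0.
- have -> : (K * mu) `^ beta * (2 * (((K * mu) `^ beta)^-1 / delta) * delta - C) =
      2 - (K * mu) `^ beta * C.
    by field; rewrite !gt_eqF.
  have : (K * mu) `^ beta <= (C + 1)^-1 by apply: h1 => //; rewrite mulrC.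
  move=> /(ler_wpM2r C0) h.
  have : (C + 1)^-1 * C <= 1 by rewrite mulrC ler_pdivrMr //; lra.
  by lra.
- apply: le_trans m4; rewrite ler_pM2l //; lra.
- have -> : mu * (D * (((K * mu) `^ beta)^-1 / delta)) =
      (D / (K * delta)) * ((K * mu) `^ (1 - beta)).
    rewrite powRB ?powRr1 ?(ltW a0) //; last by rewrite (gt_eqF a0) implybT.
    by field; rewrite !gt_eqF.
  have : (K * mu) `^ (1 - beta) <= eta / (D / (K * delta) + 1).
    by apply: h2 => //; rewrite mulrC.
  rewrite ler_pdivlMr // mulrC => h; apply: le_trans h.
  by rewrite ler_wpM2r ?powR_ge0 //; lra.
Qed.

Section SmallDiffusion.
Variables (R : realType) (d : nat) (T : R) (H : 'rV[R]_d -> R).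
Variables (m : R -> 'rV[R]_d -> R) (lam : R -> R) (x0 : 'rV[R]_d).
Hypothesis T0 : 0 < T.
Hypothesis HH : assumptionsH H.
Hypothesis mC : C12per T m.
Hypothesis eig : forall mu, 0 < mu -> is_eigenvalue T H m mu (lam mu).

Let g0 (i : 'I_d) := corrector T (fun t => pdx i (m t)).
Let h0 (i : 'I_d) := corrector T (fun t => pdx i (pdx i (m t))).

Lemma corrector_jet :
  jet (corrector T m) (fun t x => mean T m x - m t x) g0 h0.
Proof.
have [mp mtp mxp mxxp] := C12per_pcont mC.
have [jt [jx jxx]] := C12per_jet mC.
split; first by move=> t x; exact: (corrector_dt T0 t x mp mtp jt).
split=> i t x.
  exact: (corrector_dx T0 t x mp (mxp i) (jx i)).
exact: (corrector_dx T0 t x (mxp i) (mxxp i) (jxx i)).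
Qed.

Let bounds : exists2 B, 0 < B & [/\ forall i t x, `|g0 i t x| <= B,
  forall t x, `|\sum_i h0 i t x| <= B & forall t x, H (\row_i g0 i t x) <= B].
Proof.
have [mp mtp mxp mxxp] := C12per_pcont mC.
have [B1 B10 hB1] := pcont_bounded_fam T0 (fun i => corrector_pcont T0 (mxp i)).
have [B2 B20 hB2] := pcont_bounded_fam T0 (fun i => corrector_pcont T0 (mxxp i)).
have [B3 B30 hB3] := H_bounded HH (ltW B10).
have B4 : 0 <= \sum_(i < d) B2 by apply: sumr_ge0 => i _; exact: ltW.
exists (B1 + \sum_(i < d) B2 + B3); first by lra.
split=> [i t x|t x|t x].
- by apply: le_trans (hB1 i t x) _; lra.
- apply: le_trans (ler_norm_sum _ _ _) _.
  apply: le_trans (ler_sum _ (fun i _ => hB2 i t x)) _; lra.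
- apply: le_trans (hB3 _ _) _; first by move=> i; rewrite mxE; exact: hB1.
  by lra.
Qed.

Lemma small_upper : (forall x, mean T m x <= mean T m x0) ->
  exists2 C, 0 < C & forall mu, 0 < mu -> - lam mu <= mean T m x0 + mu * C.
Proof.
move=> mmax; have [B B0 [hg hh hH]] := bounds.
exists (B + B); first by lra.
move=> mu mu0; have [phi [phiC eqn]] := eig mu0.
have [mp _ _ _] := C12per_pcont mC; have [pp _ _ _] := C12per_pcont phiC.
have [t [x mx]] := pcont_max T0 0 (pcont_sub (corrector_pcont T0 mp) pp) (lexx 0).
have /(_ t x) := eigen_le (ltW mu0) phiC eqn corrector_jet.
move=> /(_ _)/le_trans; apply.
  by move=> t' x'; have := mx t' x'; rewrite !mul0r !subr0.
rewrite /pde_op addrCA subrr addr0; apply: lerD => //.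
rewrite ler_pM2l //; apply: lerD => //.
by rewrite lerNl; have := hh t x; rewrite ler_norml => /andP[].
Qed.

Lemma small_lower e : 0 < e -> exists2 r, 0 < r & forall mu, 0 < mu -> mu <= r ->
  mean T m x0 - e <= - lam mu.
Proof.
move=> e0; have [B B0 [hg hh hH]] := bounds.
have [mp _ _ _] := C12per_pcont mC.
(* [M] is what the Hamiltonian has to compensate away from [x0]. *)
have [M M0 hM] : exists2 M, 0 < M & forall x, mean T m x0 - mean T m x <= M.
  have [M M0 hM] := pcont_bounded T0 mp.
  exists (M + M) => [|x]; first by lra.
  rewrite /mean -mulrBr mulrC ler_pdivrMr //.
  apply: le_trans (ler_norm _) _; rewrite -[X in _ * X]subr0.
  apply: int_ab_dist; [exact: ltW|exact: cont_slice mp|exact: cont_slice mp|].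
  by move=> s _; apply: le_trans (ler_normB _ _) _; exact: lerD.
have e2 : 0 < e / 2 by lra.
have [delta delta0 hdelta] := mean_unif T0 mp e2.
have [c c0 hc] := H_lower HH.
have [beta [b0 b1 hb]] := H_superlinear HH.
pose D := \sum_(i < d) (2 : R).
have D0 : 0 <= D by apply: sumr_ge0.
have K0 : 0 < c / M by apply: divr_gt0.
have e4 : 0 < e / 4 by lra.
have [r r0 hr] := dominate_drift b0 b1 K0 (ltW B0) delta0 e4 D0.
exists r => // mu mu0 mur; have [L [L0 a1 La muB muL]] := hr _ mu0 mur.
have [phi [phiC eqn]] := eig mu0; have [pp _ _ _] := C12per_pcont phiC.
have [t [x mx]] := pcont_max T0 x0 (pcont_sub pp (corrector_pcont T0 mp)) (ltW L0).
have J := jet_add corrector_jet (jet_scale L (jet_sqdist x0)).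
have /(_ t x) := eigen_ge (ltW mu0) phiC eqn J.
move=> /(_ _)/(le_trans _); apply; last first.
  by move=> t' x'; have := mx t' x'; rewrite !opprD !addrA.
rewrite /pde_op mulr0 addr0 [m t x + _]addrC subrK big_split /=.
set p := \row_i _.
have -> : \sum_(i < d) L * 2 = D * L by rewrite -mulr_sumr mulrC.
have hS : mu * (\sum_i h0 i t x) <= mu * B.
  by rewrite ler_pM2l //; have := hh t x; rewrite ler_norml => /andP[].
have a0 : 0 < c / M * mu by apply: mulr_gt0.
rewrite mulrDr mulrN mulrDr.
(* Within [delta] of [x0] the mean loses at most [e / 2] and [H >= 0] suffices. Farther away the
   gradient of the penalty dominates that of the corrector. In both cases the two Laplacians cost
   [e / 4] each. *)
have [xd|xd] := leP `|x0 - x| delta.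
  have := hdelta _ _ xd; rewrite ler_norml => /andP[_ h].
  have : 0 <= mu * H p by rewrite mulr_ge0 ?H_ge0 // ltW.
  by lra.
have hp : 2 * L * delta - B <= `|p|.
  have -> : p = (2 * L) *: (x - x0) - \row_i - g0 i t x.
    by apply/rowP => i; rewrite !mxE; ring.
  apply: le_trans _ (lerB_dist _ _); apply: lerB.
    rewrite normrZ gtr0_norm ?mulr_gt0 // ler_pM2l ?mulr_gt0 //.
    by rewrite distrC ltW.
  by apply: norm_coord_le => [|i]; [exact: ltW|rewrite mxE normrN].
have hp1 : 1 <= `|(c / M * mu) `^ beta *: p|.
  rewrite normrZ ger0_norm ?powR_ge0 //; apply: le_trans La _.
  by rewrite ler_wpM2l ?powR_ge0.
(* With [a = c / M * mu] this reads [c <= a * H p], that is [M <= mu * H p]. *)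
have := le_trans (hc _ hp1) (hb _ p a0 a1).
rewrite -mulrA mulrAC ler_pdivlMr // ler_pM2l // => hMH.
by have := hM x; lra.
Qed.

End SmallDiffusion.

(** * Discrete Fejer kernels *)

Lemma cosM2 (R : realType) (a b : R) :
  2 * (cos a * cos b) = cos (a + b) + cos (a - b).
Proof. by rewrite cosD cosB; ring. Qed.

Lemma cos_lt1 (R : realType) (z : R) : 0 < `|z| < 1 -> cos (pi *+ 2 * z) < 1.
Proof.
move=> /andP[z0 z1]; rewrite -cos_norm normrM [X in X * _]gtr0_norm; last first.
  by rewrite mulrn_wgt0 // pi_gt0.
rewrite mulrnAl cos_mulr2n cos2sin2.
have : 0 < sin (pi * `|z|).
  apply: sin_gt0_pi; rewrite mulr_gt0 ?pi_gt0 //=.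
  by rewrite -[ltRHS]mulr1 ltr_pM2l ?pi_gt0.
move=> /(exprn_gt0 2); rewrite mulr2n; lra.
Qed.

Section Fejer.
Variables (R : realType) (d n : nat).

Definition dotZ (q : 'I_d -> int) (x : 'rV[R]_d) : R := \sum_i (q i)%:~R * x 0 i.

Lemma dotZB q x y : dotZ q (x - y) = dotZ q x - dotZ q y.
Proof.
rewrite /dotZ -sumrB; apply: eq_bigr => i _; rewrite !mxE; ring.
Qed.

Lemma cos_intD (y : R) (z : int) : cos (y + pi *+ 2 * z%:~R) = cos y.
Proof. by rewrite mulrzr (periodicMz (@cosD2pi R)). Qed.

Local Notation G := {ffun 'I_d -> 'I_n.+2}.
Local Notation K := {ffun 'I_d -> 'I_n.+1}.

(** With [n + 2] points per axis there is no aliasing: the frequencies are differences of size at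
    most [n], moved by at most one in [fejer_cos], so only 0 is divisible by [n + 2]. *)
Definition gridpt (j : G) : 'rV[R]_d := \row_i ((j i)%:R / n.+2%:R).

Definition gshift (i0 : 'I_d) : G := [ffun i => if i == i0 then 1 else 0].

(** Addition of indices is modulo [n + 2]; wrapping around produces the integer [z], to which the
    cosines are blind. *)
Lemma dotZ_gshift q i0 (j : G) : exists z : int,
  dotZ q (gridpt (j + gshift i0)) =
  dotZ q (gridpt j) + (q i0)%:~R / n.+2%:R + z%:~R.
Proof.
exists (- (q i0) * ((j i0 + 1) %/ n.+2)%:Z).
rewrite /dotZ (bigD1 i0) //= [X in _ = X + _ + _](bigD1 i0) //=.
have -> : \sum_(i < d | i != i0) (q i)%:~R * gridpt (j + gshift i0) 0 i =
          \sum_(i < d | i != i0) (q i)%:~R * gridpt j 0 i :> R.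
  by apply: eq_bigr => i ii; rewrite !mxE !ffunE (negbTE ii) addr0.
rewrite !mxE !ffunE eqxx.
have -> : nat_of_ord (j i0 + 1) = ((j i0 + 1) %% n.+2)%N.
  by rewrite /= modnS.
have : (j i0 + 1)%:R = ((j i0 + 1) %/ n.+2)%:R * n.+2%:R + ((j i0 + 1) %% n.+2)%:R :> R.
  by rewrite -natrM -natrD -divn_eq.
rewrite natrD => h.
have -> : ((j i0 + 1) %% n.+2)%:R = (j i0)%:R + 1 - ((j i0 + 1) %/ n.+2)%:R * n.+2%:R :> R.
  by rewrite h; ring.
have n2 : n.+2%:R != 0 :> R by rewrite pnatr_eq0.
by rewrite rmorphM rmorphN /= -pmulrn; move: n2; move: (n.+2%:R : R) => w n2; field.
Qed.

(* The sum [S] is unchanged when its phase moves by one grid step [al], and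
   [S (A + al) + S (A - al) = 2 cos al S A] with [cos al < 1]. *)
Lemma grid_cos0 q (A : R) i0 : q i0 != 0 -> `|q i0| < n.+2%:Z ->
  \sum_(j : G) cos (A - pi *+ 2 * dotZ q (gridpt j)) = 0.
Proof.
move=> q0 qn; pose S B := \sum_(j : G) cos (B - pi *+ 2 * dotZ q (gridpt j)).
pose z : R := (q i0)%:~R / n.+2%:R; pose al := pi *+ 2 * z.
have shiftS B : S (B - al) = S B.
  rewrite /S [RHS](reindex_inj (addIr (gshift i0))); apply: eq_bigr => j _ /=.
  have [w ->] := dotZ_gshift q i0 j.
  rewrite -(cos_intD (B - al - _) (- w)); congr cos.
  by rewrite rmorphN /= /al /z; ring.
have e1 := shiftS A.
have e2 : S (A + al) = S A by rewrite -(shiftS (A + al)) addrK.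
have h : S A *+ 2 = 2 * cos al * S A.
  rewrite mulr2n -{1}e2 -{1}e1 /S -big_split mulr_sumr /=.
  apply: eq_bigr => j _; rewrite -mulrA [cos al * _]mulrC cosM2.
  by congr (cos _ + cos _); ring.
have zr : 0 < `|z| < 1.
  rewrite normrM [X in _ * X]gtr0_norm ?invr_gt0 ?ltr0n //; apply/andP; split.
    by rewrite divr_gt0 ?ltr0n // normr_gt0 intr_eq0.
  rewrite ltr_pdivrMr ?ltr0n // mul1r -intr_norm.
  by rewrite -(ltr_int R) in qn.
have c1 := cos_lt1 zr.
have : (1 - cos al) * S A = 0 by move: h; rewrite mulr2n => h; lra.
by move=> /eqP; rewrite mulf_eq0 subr_eq0 eq_sym (lt_eqF c1) /= => /eqP.
Qed.

Lemma grid_cos q (A : R) : (forall i, `|q i| < n.+2%:Z) ->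
  \sum_(j : G) cos (A - pi *+ 2 * dotZ q (gridpt j)) =
  if [forall i, q i == 0] then #|G|%:R * cos A else 0.
Proof.
move=> qn; case: ifP => [/forallP q0|/negbT].
  rewrite (eq_bigr (fun=> cos A)) => [|j _]; first by rewrite sumr_const mulr_natl.
  by rewrite /dotZ big1 ?mulr0 ?subr0 // => i _; rewrite (eqP (q0 i)) mul0r.
by rewrite negb_forall => /existsP[i qi]; exact: (grid_cos0 A qi (qn i)).
Qed.

Definition dif (k l : K) (i : 'I_d) : int := (k i)%:Z - (l i)%:Z.

Lemma dif_bound k l i : `|dif k l i| <= n%:Z.
Proof.
have := ltn_ord (k i); have := ltn_ord (l i); rewrite /dif ler_norml => h1 h2.
by apply/andP; split; lia.
Qed.

Lemma dif_eq0 k l : [forall i, dif k l i == 0] = (k == l).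
Proof.
apply/forallP/eqP => [h|-> i]; last by rewrite /dif subrr.
by apply/ffunP => i; apply/val_inj; have := h i; rewrite subr_eq0 => /eqP[].
Qed.

(** The double sum is [|sum_k exp (2 pi i k . z)|^2] for [z = x - gridpt j], a product of
    one-dimensional Fejer kernels, hence nonnegative. The prefactor makes the values at a fixed [x]
    sum to 1 over the grid. *)
Definition fejer (j : G) (x : 'rV[R]_d) : R := (#|G|%:R * #|K|%:R)^-1 *
  \sum_(k : K) \sum_(l : K) cos (pi *+ 2 * dotZ (dif k l) (x - gridpt j)).

Let G0 : 0 < #|G|%:R :> R.
Proof. by rewrite ltr0n; apply/card_gt0P; exists 0. Qed.

Let K0 : 0 < #|K|%:R :> R.
Proof. by rewrite ltr0n; apply/card_gt0P; exists [ffun=> ord0]. Qed.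

Lemma fejer_ge0 j x : 0 <= fejer j x.
Proof.
apply: mulr_ge0; first by rewrite invr_ge0 mulr_ge0 // ltW.
pose th (k : K) : R := pi *+ 2 * dotZ (fun i => (k i)%:Z) (x - gridpt j).
have -> : \sum_(k : K) \sum_(l : K) cos (pi *+ 2 * dotZ (dif k l) (x - gridpt j)) =
   (\sum_k cos (th k)) * (\sum_k cos (th k)) + (\sum_k sin (th k)) * (\sum_k sin (th k)).
  rewrite !big_distrlr /= -big_split; apply: eq_bigr => k _.
  rewrite -big_split; apply: eq_bigr => l _ /=; rewrite -cosB; congr cos.
  rewrite /th -mulrBr; congr (_ * _); rewrite /dotZ -sumrB; apply: eq_bigr => i _.
  by rewrite /dif rmorphB /= mulrBl.
by rewrite addr_ge0 // -expr2 sqr_ge0.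
Qed.

(** Summation over the grid kills every frequency [k - l] except 0, which occurs [#|K|] times. *)
Lemma fejer_sum x : \sum_j fejer j x = 1.
Proof.
rewrite -mulr_sumr exchange_big /=.
have -> : \sum_(k : K) \sum_j \sum_(l : K) cos (pi *+ 2 * dotZ (dif k l) (x - gridpt j)) =
    \sum_(k : K) #|G|%:R.
  apply: eq_bigr => k _; rewrite exchange_big /= (bigD1 k) //= [X in _ + X]big1 => [|l lk].
    rewrite addr0; under eq_bigr do rewrite dotZB mulrBr.
    rewrite grid_cos => [|i]; last by rewrite /dif subrr normr0.
    rewrite dif_eq0 eqxx /dotZ big1 ?mulr0 ?cos0 ?mulr1 // => i _.
    by rewrite /dif subrr mul0r.
  under eq_bigr do rewrite dotZB mulrBr.
  rewrite grid_cos => [|i]; last by apply: le_lt_trans (dif_bound k l i) _; lia.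
  by rewrite dif_eq0 eq_sym (negbTE lk).
by rewrite sumr_const -(mulr_natr #|G|%:R #|K|) mulVf // mulf_neq0 // gt_eqF.
Qed.

(** Translation by a constant function permutes [K] and carries one fibre to another, so the [n + 1]
    fibres have equal size. *)
Lemma card_fibre (i : 'I_d) (c : 'I_n.+1) :
  \sum_(k : K) (k i == c)%:R = #|K|%:R / n.+1%:R :> R.
Proof.
have E c' : \sum_(k : K) (k i == c')%:R = \sum_(k : K) (k i == c)%:R :> R.
  rewrite (reindex_inj (addIr ([ffun=> c' - c] : K))); apply: eq_bigr => k _ /=.
  by rewrite !ffunE addrA subr_eq [k i + _]addrC (inj_eq (addrI _)).
apply/eqP; rewrite -[_ == _](inj_eq (mulIf (_ : n.+1%:R != 0))) ?pnatr_eq0 //.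
rewrite divfK ?pnatr_eq0 // mulr_natr -[X in _ *+ X]card_ord -sumr_const.
rewrite (eq_bigr (fun c' => \sum_(k : K) (k i == c')%:R)) => [|c' _]; last by rewrite E.
rewrite exchange_big /= (eq_bigr (fun=> 1)) ?sumr_const // => k _.
by rewrite (bigD1 (k i)) //= eqxx big1 ?addr0 // => j; rewrite eq_sym => /negbTE ->.
Qed.

(** Multiplying by this cosine moves the frequency [k - l] by one unit along [i], half up and half
    down, so by [grid_cos] the sum counts the pairs in which [l] is [k] moved by one unit along [i].
    For each sign the only [k] without a partner lie on one face of the box, a fraction
    [1 / (n + 1)] of [K]. *)
Lemma fejer_cos x i : 1 - n.+1%:R^-1 <=
  \sum_j fejer j x * cos (pi *+ 2 * (x - gridpt j) 0 i).
Proof.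
pose e (s : int) (k l : K) (i' : 'I_d) : int := dif k l i' + (if i' == i then s else 0).
have dote s k l y : dotZ (e s k l) y = dotZ (dif k l) y + s%:~R * y 0 i.
  rewrite /dotZ (bigD1 i) //= [X in _ = X + _](bigD1 i) //= /e eqxx rmorphD /=.
  have -> : \sum_(j < d | j != i) (dif k l j + (if j == i then s else 0))%:~R * y 0 j =
     \sum_(j < d | j != i) (dif k l j)%:~R * y 0 j :> R.
    by apply: eq_bigr => j /negbTE ->; rewrite addr0.
  ring.
have ebound s k l i' : `|s| <= 1 -> `|e s k l i'| < n.+2%:Z.
  move=> s1; apply: (@le_lt_trans _ _ (n%:Z + 1)); last by lia.
  apply: le_trans (ler_normD _ _) _; apply: lerD; first exact: dif_bound.
  by case: ifP => // _; rewrite normr0.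
have Ge (s : int) k l : `|s| <= 1 ->
    \sum_(j : G) cos (pi *+ 2 * dotZ (e s k l) (x - gridpt j)) =
    if [forall i', e s k l i' == 0] then #|G|%:R else 0.
  move=> s1; under eq_bigr do rewrite dotZB mulrBr.
  rewrite grid_cos => [|i']; last exact: ebound.
  case: ifP => // /forallP h; rewrite /dotZ big1 ?mulr0 ?cos0 ?mulr1 // => j _.
  by rewrite (eqP (h j)) mul0r.
have nn0 : n.+1%:R != 0 :> R by rewrite pnatr_eq0.
have cnt (s : int) : s = 1 \/ s = - 1 -> #|K|%:R * (1 - n.+1%:R^-1) <=
   \sum_(k : K) \sum_(l : K) (if [forall i', e s k l i' == 0] then 1 else 0) :> R.
  (* [c] is the extreme value of [k i] at which [k i + s] leaves the range. *)
  move=> hs; pose c : 'I_n.+1 := if s == 1 then ord_max else ord0.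
  have -> : #|K|%:R * (1 - n.+1%:R^-1) = \sum_(k : K) (1 - (k i == c)%:R) :> R.
    by rewrite sumrB sumr_const card_fibre mulrBr mulr1.
  apply: ler_sum => k _; case: eqP => [_|kc].
    by rewrite subrr; apply: sumr_ge0 => l _; case: ifP.
  rewrite subr0.
  have [l hl] : exists l : K, [forall i', e s k l i' == 0].
    exists [ffun i' => if i' == i then inord (absz ((k i)%:Z + s)%R) else k i'].
    apply/forallP => i'; rewrite /e /dif ffunE; case: ifP => [/eqP ->|_]; last first.
      by rewrite subrr addr0.
    have kn := ltn_ord (k i).
    have [k1 k2] : 0 <= (k i)%:Z + s /\ (k i)%:Z + s < n.+1%:Z.
      have : nat_of_ord (k i) <> nat_of_ord c by move=> /val_inj.
      by rewrite /c; case: hs kn => -> /= kn kc'; split; lia.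
    have az := gez0_abs k1.
    rewrite inordK ?az; last by rewrite -ltz_nat az.
    by rewrite opprD addrA subrr add0r addNr.
  rewrite (bigD1 l) //= hl lerDl; apply: sumr_ge0 => l' _; by case: ifP.
have -> : \sum_j fejer j x * cos (pi *+ 2 * (x - gridpt j) 0 i) =
  (2 * #|K|%:R)^-1 *
  (\sum_(k : K) \sum_(l : K) (if [forall i', e 1 k l i' == 0] then 1 else 0) +
   \sum_(k : K) \sum_(l : K) (if [forall i', e (-1) k l i' == 0] then 1 else 0)).
  have -> : \sum_j fejer j x * cos (pi *+ 2 * (x - gridpt j) 0 i) =
    (#|G|%:R * #|K|%:R)^-1 * (2^-1 * \sum_(k : K) \sum_(l : K) \sum_j
     (cos (pi *+ 2 * dotZ (e 1 k l) (x - gridpt j)) +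
      cos (pi *+ 2 * dotZ (e (-1) k l) (x - gridpt j)))).
    under [X in _ = _ * (_ * X)]eq_bigr do rewrite exchange_big /=.
    rewrite [X in _ = _ * (_ * X)]exchange_big /= mulr_sumr mulr_sumr.
    apply: eq_bigr => j _; rewrite /fejer -mulrA; congr (_ * _).
    rewrite mulr_suml mulr_sumr; apply: eq_bigr => k _.
    rewrite mulr_suml mulr_sumr; apply: eq_bigr => l _.
    have two0 : 2 != 0 :> R by rewrite pnatr_eq0.
    rewrite -[LHS](mulKf two0) cosM2.
    by congr (_ * (cos _ + cos _)); rewrite dote; ring.
  under eq_bigr do under eq_bigr do rewrite big_split /= !Ge //.
  have sE s : \sum_(k : K) \sum_(l : K) (if [forall i', e s k l i' == 0] then #|G|%:R else 0) =
     #|G|%:R * \sum_(k : K) \sum_(l : K) (if [forall i', e s k l i' == 0] then 1 else 0) :> R.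
    rewrite mulr_sumr; apply: eq_bigr => k _; rewrite mulr_sumr; apply: eq_bigr => l _.
    by case: ifP; rewrite ?mulr1 ?mulr0.
  under eq_bigr do rewrite big_split /=.
  rewrite big_split /= !sE; field.
  by rewrite !gt_eqF.
have h1 := cnt 1 (or_introl erefl); have h2 := cnt (-1) (or_intror erefl).
rewrite mulrC ler_pdivlMr ?mulr_gt0 //; apply: le_trans _ (lerD h1 h2).
by rewrite le_eqVlt; apply/orP; left; apply/eqP; ring.
Qed.

(* Korovkin's argument: the weights [fejer j x] form a probability on the grid
   concentrated near [x], since their first moments against [1 - cos] are small. *)
Lemma fejer_approx (f : 'rV[R]_d -> R) (e C : R) x : 0 <= C ->
  (forall y, `|f x - f y| <= e + C * \sum_i (1 - cos (pi *+ 2 * (x - y) 0 i))) ->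
  `|f x - \sum_j f (gridpt j) * fejer j x| <= e + C * (d%:R / n.+1%:R).
Proof.
move=> C0 hf.
have -> : f x - \sum_j f (gridpt j) * fejer j x =
          \sum_j (f x - f (gridpt j)) * fejer j x.
  under [RHS]eq_bigr do rewrite mulrBl.
  by rewrite sumrB -mulr_sumr fejer_sum mulr1.
apply: le_trans (ler_norm_sum _ _ _) _.
apply: (@le_trans _ _ (\sum_j (e * fejer j x + C * \sum_i
    (fejer j x - fejer j x * cos (pi *+ 2 * (x - gridpt j) 0 i))))).
  apply: ler_sum => j _; rewrite normrM [X in _ * X]ger0_norm ?fejer_ge0 //.
  have -> : e * fejer j x + C * \sum_i (fejer j x -
       fejer j x * cos (pi *+ 2 * (x - gridpt j) 0 i)) =
     (e + C * \sum_i (1 - cos (pi *+ 2 * (x - gridpt j) 0 i))) * fejer j x.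
    rewrite mulrDl -mulrA mulr_suml; congr (_ + _ * _); apply: eq_bigr => i _; ring.
  by rewrite ler_wpM2r ?fejer_ge0.
rewrite big_split /= -[X in X + _]mulr_sumr -[X in _ + X]mulr_sumr fejer_sum mulr1.
rewrite lerD2l ler_wpM2l // exchange_big /=.
apply: (@le_trans _ _ (\sum_(i < d) n.+1%:R^-1)).
  apply: ler_sum => i _; rewrite sumrB fejer_sum.
  by rewrite lerBlDr addrC -lerBlDr; exact: fejer_cos.
by rewrite sumr_const card_ord mulr_natl.
Qed.

End Fejer.

(** * Integrals over the torus *)

Section Cube.
Variable R : realType.
Implicit Types (F G : (nat -> R) -> R).

(** Uniform continuity for the sup distance on sequences, the arguments of [icube]. It survives
    freezing a coordinate, so every inner integral is continuous in the outer variable. *)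
Definition ucn F := forall e : R, 0 < e -> exists2 r : R, 0 < r &
  forall x y, (forall k, `|x k - y k| <= r) -> `|F x - F y| <= e.

Definition fixc n (s : R) (x : nat -> R) : nat -> R := fun k => if k == n then s else x k.

Lemma ucn_fix F n s : ucn F -> ucn (fun x => F (fixc n s x)).
Proof.
move=> uF e e0; have [r r0 hr] := uF e e0; exists r => // x y hxy.
by apply: hr => k; rewrite /fixc; case: eqP => // _; rewrite subrr normr0 ltW.
Qed.

Lemma cont_of_dist (f : R -> R) : (forall e, 0 < e -> exists2 r, 0 < r &
  forall s s', `|s - s'| <= r -> `|f s - f s'| <= e) -> continuous f.
Proof.
move=> uf s; apply/cvgrPdist_le => e e0; have [r r0 hr] := uf e e0.
apply: filterS (nbhsx_ballx s r r0) => s' /=.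
by rewrite /ball /= => h; apply: hr; exact: ltW.
Qed.

Lemma icube_dist n F G e : ucn F -> ucn G -> (forall x, `|F x - G x| <= e) ->
  `|icube n F - icube n G| <= e.
Proof.
elim: n F G e => [|n IH] F G e uF uG h /=; first exact: h.
(* The induction hypothesis, applied to one function frozen at two values of [s], yields the
   continuity needed to integrate in [s]. *)
have cont F' : ucn F' -> continuous (fun s => icube n (fun x => F' (fixc n s x))).
  move=> uF'; apply: cont_of_dist => e' e0; have [r r0 hr] := uF' e' e0.
  exists r => // s s' hs; apply: IH => [||x]; [exact: ucn_fix|exact: ucn_fix|].
  by apply: hr => k; rewrite /fixc; case: eqP => // _; rewrite subrr normr0 ltW.
rewrite -[leRHS]mulr1 -[X in e * X](subr0 1).
apply: int_ab_dist; [exact: ler01|exact: cont|exact: cont|].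
by move=> s _; apply: IH => [||x]; [exact: ucn_fix|exact: ucn_fix|exact: h].
Qed.

Lemma icube_cont n F : ucn F -> continuous (fun s => icube n (fun x => F (fixc n s x))).
Proof.
move=> uF; apply: cont_of_dist => e e0; have [r r0 hr] := uF e e0.
exists r => // s s' hs; apply: icube_dist => [||x]; [exact: ucn_fix|exact: ucn_fix|].
by apply: hr => k; rewrite /fixc; case: eqP => // _; rewrite subrr normr0 ltW.
Qed.

Lemma ucn_add F G : ucn F -> ucn G -> ucn (fun x => F x + G x).
Proof.
move=> uF uG e e0; have e2 : 0 < e / 2 by lra.
have [r r0 hr] := uF _ e2; have [s s0 hs] := uG _ e2.
exists (Num.min r s) => [|x y hxy]; first by rewrite lt_min r0.
rewrite opprD addrACA [e]splitr; apply: le_trans (ler_normD _ _) _; apply: lerD.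
  by apply: hr => k; apply: le_trans (hxy k) _; rewrite ge_min lexx.
by apply: hs => k; apply: le_trans (hxy k) _; rewrite ge_min lexx orbT.
Qed.

Lemma ucn_scale c F : ucn F -> ucn (fun x => c * F x).
Proof.
move=> uF e e0; have c0 : 0 < `|c| + 1 by rewrite ltr_wpDl.
have e1 : 0 < e / (`|c| + 1) by apply: divr_gt0.
have [r r0 hr] := uF _ e1; exists r => // x y /hr h.
rewrite -mulrBr normrM.
have -> : e = (`|c| + 1) * (e / (`|c| + 1)) by rewrite mulrC divfK // gt_eqF.
by apply: ler_pM => //; rewrite lerDl.
Qed.

Lemma ucn_cst c : ucn (fun=> c).
Proof. by move=> e e0; exists 1 => // x y _; rewrite subrr normr0 ltW. Qed.

Lemma icubeD n F G : ucn F -> ucn G ->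
  icube n (fun x => F x + G x) = icube n F + icube n G.
Proof.
elim: n F G => [|n IH] F G uF uG //=.
rewrite -int_abD; [|exact: icube_cont|exact: icube_cont].
by apply: int_ab_ext => s; apply: IH; exact: ucn_fix.
Qed.

Lemma icubeZ n c F : ucn F -> icube n (fun x => c * F x) = c * icube n F.
Proof.
elim: n F => [|n IH] F uF //=.
rewrite -int_abZ; last exact: icube_cont.
by apply: int_ab_ext => s; apply: (IH (fun x => F (fixc n s x))); exact: ucn_fix.
Qed.

Lemma icube_cst n c : icube n (fun=> c) = c :> R.
Proof. by elim: n => [|n IH] //=; rewrite IH int_ab_cst // subr0 mulr1. Qed.

Lemma icube_sum n (I : Type) (r : seq I) (F : I -> (nat -> R) -> R) :
  (forall i, ucn (F i)) -> ucn (fun x => \sum_(i <- r) F i x) /\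
  icube n (fun x => \sum_(i <- r) F i x) = \sum_(i <- r) icube n (F i).
Proof.
move=> uF; elim: r => [|a r [u e]].
  rewrite big_nil (_ : (fun x => _) = (fun=> 0)); last by apply/funext => x; rewrite big_nil.
  by split; [exact: ucn_cst|exact: icube_cst].
rewrite big_cons (_ : (fun x => _) = (fun x => F a x + \sum_(i <- r) F i x)); last first.
  by apply/funext => x; rewrite big_cons.
by split; [exact: ucn_add|rewrite icubeD // e].
Qed.

Lemma cos_lipschitz (a b : R) : `|cos a - cos b| <= `|a - b|.
Proof.
wlog ab : a b / a < b => [h|].
  have [ab|ba|->] := ltgtP a b; first exact: h.
    by rewrite distrC [leRHS]distrC; exact: h.
  by rewrite !subrr.
have cc := is_derive_continuous (fun s : R => is_derive_cos s).
have [c _ e] := MVT ab (fun z _ => is_derive_cos z) (continuous_subspaceT cc).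
rewrite distrC e normrM normrN [leRHS]distrC -[leRHS]mul1r.
by apply: ler_wpM2r => //; exact: sin_max.
Qed.

Lemma ucn_cos n (q : nat -> int) (A : R) :
  ucn (fun x => cos (A + pi *+ 2 * \sum_(k < n) (q k)%:~R * x k)).
Proof.
move=> e e0; pose C : R := `|pi *+ 2| * \sum_(k < n) `|(q k)%:~R| + 1.
have C0 : 0 < C.
  by rewrite ltr_wpDl // mulr_ge0 // sumr_ge0.
exists (e / C) => [|x y hxy]; first exact: divr_gt0.
apply: le_trans (cos_lipschitz _ _) _.
rewrite opprD addrACA subrr add0r -mulrBr -sumrB normrM.
have e1 : 0 <= e / C by rewrite ltW // divr_gt0.
apply: (@le_trans _ _ ((C - 1) * (e / C))); last first.
  by rewrite mulrBl mul1r [C * _]mulrC divfK ?gt_eqF // lerBlDr lerDl.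
rewrite /C addrK -mulrA; apply: ler_wpM2l => //; rewrite mulr_suml.
apply: le_trans (ler_norm_sum _ _ _) _; apply: ler_sum => k _.
by rewrite -mulrBr normrM; apply: ler_wpM2l.
Qed.

(** In the induction the outermost coordinate is absorbed into the phase, which is why [A] is
    arbitrary. Either an inner frequency is nonzero and the inner integral vanishes, or the
    integrand depends on [s] alone and is integrated over whole periods. *)
Lemma icube_cos n (q : nat -> int) (A : R) k0 : (k0 < n)%N -> q k0 != 0 ->
  icube n (fun x => cos (A + pi *+ 2 * \sum_(k < n) (q k)%:~R * x k)) = 0.
Proof.
elim: n A k0 => [//|n IH] A k0 kn qk /=.
have E s x : A + pi *+ 2 * (\sum_(k < n.+1) (q k)%:~R * fixc n s x k) =
    (A + pi *+ 2 * ((q n)%:~R * s)) + pi *+ 2 * \sum_(k < n) (q k)%:~R * x k.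
  rewrite big_ord_recr /= {2}/fixc eqxx.
  rewrite (eq_bigr (fun k : 'I_n => (q k)%:~R * x k)) => [|k _]; first by ring.
  by rewrite /fixc (ltn_eqF (ltn_ord k)).
rewrite (_ : (fun s => _) = (fun s => icube n (fun x =>
   cos ((A + pi *+ 2 * ((q n)%:~R * s)) + pi *+ 2 * \sum_(k < n) (q k)%:~R * x k))));
   last by apply/funext => s; congr (icube n _); apply/funext => x; rewrite -E.
have [/existsP[k qk']|] := boolP [exists k : 'I_n, q k != 0].
  rewrite (_ : (fun s => _) = (fun=> 0)); last first.
    by apply/funext => s; exact: (IH _ k (ltn_ord k) qk').
  by rewrite int_ab_cst // mul0r.
rewrite negb_exists => /forallP qz.
have {}qz (k : 'I_n) : q k = 0 by apply/eqP; have := qz k; rewrite negbK.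
have qn : q n != 0.
  move: kn; rewrite ltnS leq_eqVlt => /orP[/eqP <- //|kn].
  by have := qz (Ordinal kn); move: qk => /= /eqP.
pose w : R := pi *+ 2 * (q n)%:~R.
have w0 : w != 0.
  by rewrite mulf_neq0 ?intr_eq0 // gt_eqF // mulrn_wgt0 // pi_gt0.
rewrite (_ : (fun s => _) = (fun s => cos (A + w * s))); last first.
  apply/funext => s; rewrite -[RHS](icube_cst n); congr (icube n _); apply/funext => x.
  by rewrite big1 ?mulr0 ?addr0 ?mulrA // => k _; rewrite qz mul0r.
have dl (s : R) : is_derive s (1 : R) (fun s => A + w * s) w.
  have := is_deriveD (is_derive_cst A s (1 : R)) (is_deriveZ w (is_derive_id s (1 : R))).
  by rewrite add0r /GRing.scale /= mulr1.
have dS (s : R) : is_derive s (1 : R) (fun s => w^-1 * sin (A + w * s)) (cos (A + w * s)).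
  have := is_deriveZ w^-1 (@is_derive1_comp R (@sin R) (fun s => A + w * s) s _ _
    (is_derive_sin (A + w * s)) (dl s)).
  by rewrite /GRing.scale /= mulrCA mulVf // mulr1.
have cc : continuous (fun s => cos (A + w * s)).
  have dC (s : R) : is_derive s (1 : R) (fun s => cos (A + w * s)) (- sin (A + w * s) * w).
    exact: (@is_derive1_comp R (@cos R) (fun s => A + w * s) s _ _
      (is_derive_cos (A + w * s)) (dl s)).
  exact: is_derive_continuous dC.
rewrite (int_ab_FTC ltr01 cc dS) mulr1 mulr0 addr0 -mulrBr.
by rewrite /w mulrzr (periodicMz (@sinD2pi R)) subrr mulr0.
Qed.

End Cube.

Section Torus.
Variables (R : realType) (d : nat) (T : R).
Hypothesis T0 : 0 < T.

Implicit Types k : R -> 'rV[R]_d -> R.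

Let row (x : nat -> R) : 'rV[R]_d := \row_i x (nat_of_ord i).

Lemma ucn_row (f : 'rV[R]_d -> R) : (forall e, 0 < e -> exists2 r, 0 < r &
   forall x y, `|x - y| <= r -> `|f x - f y| <= e) -> ucn (fun x => f (row x)).
Proof.
move=> uf e e0; have [r r0 hr] := uf e e0; exists r => // x y h.
by apply: hr; apply: norm_coord_le; [exact: ltW|move=> i; rewrite !mxE].
Qed.

Lemma ucn_pcont k t : pcont T k -> ucn (fun x => k t (row x)).
Proof.
move=> kp; apply: ucn_row => e e0; have [r r0 hr] := pcont_unif T0 kp e0.
by exists r => // x y h; apply: hr => //; rewrite subrr normr0 ltW.
Qed.

(** Frequency 0 is tolerated where the coefficient vanishes; this is how the diagonal pairs of
    [poisson_approx] enter. *)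
Lemma torus_int_modes (I : finType) (c : R) (b A : I -> R) (q : I -> 'I_d -> int) :
  (forall w, b w != 0 -> exists i, q w i != 0) ->
  ucn (fun x => c + \sum_w b w * cos (A w + pi *+ 2 * dotZ (q w) (row x))) /\
  torus_int (fun x => c + \sum_w b w * cos (A w + pi *+ 2 * dotZ (q w) x)) = c.
Proof.
move=> hq; pose q' w (k : nat) := oapp (q w) 0 (insub k).
have E w x : dotZ (q w) (row x) = \sum_(k < d) (q' w k)%:~R * x k.
  by apply: eq_bigr => i _; rewrite mxE /q' valK.
have uc w : ucn (fun x => cos (A w + pi *+ 2 * dotZ (q w) (row x))).
  have := ucn_cos d (q' w) (A w); congr ucn.
  by apply/funext => x; rewrite E.
have [us es] := icube_sum d (index_enum I) (fun w => ucn_scale (b w) (uc w)).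
split; first by apply: ucn_add => //; exact: ucn_cst.
rewrite /torus_int -/(row _) icubeD //; last exact: ucn_cst.
rewrite icube_cst es big1 ?addr0 // => w _; rewrite icubeZ //.
have [->|bw] := eqVneq (b w) 0; first by rewrite mul0r.
have [i qi] := hq w bw.
have := @icube_cos _ d (q' w) (A w) i (ltn_ord i).
rewrite /q' valK => /(_ qi) h.
rewrite (_ : icube d _ = 0) ?mulr0 // -[RHS]h; congr (icube d _).
by apply/funext => x; rewrite E.
Qed.

(** Integrating the uniform bound kills every mode and leaves [c]; this compares a grid mean with
    the integral. *)
Lemma torus_int_close k t (I : finType) (c e : R) (b A : I -> R) (q : I -> 'I_d -> int) :
  pcont T k -> (forall w, b w != 0 -> exists i, q w i != 0) ->
  (forall x, `|k t x - (c + \sum_w b w * cos (A w + pi *+ 2 * dotZ (q w) x))| <= e) ->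
  `|torus_int (k t) - c| <= e.
Proof.
move=> kp hq h; have [u <-] := torus_int_modes c A hq.
by apply: icube_dist => //; exact: ucn_pcont.
Qed.

Lemma torus_int_cont k : pcont T k -> continuous (fun t => torus_int (k t)).
Proof.
move=> kp; apply: cont_of_dist => e e0; have [r r0 hr] := pcont_unif T0 kp e0.
exists r => // s s' hs; apply: icube_dist; [exact: ucn_pcont|exact: ucn_pcont|].
by move=> x; apply: hr => //; rewrite subrr normr0 ltW.
Qed.

Lemma cos_gap (r : R) : 0 < r -> exists2 c, 0 < c &
  forall z, r <= `|z| -> `|z| <= 1 / 2 -> c <= 1 - cos (pi *+ 2 * z).
Proof.
move=> r0; have [r12|r12] := leP r (1 / 2); last first.
  by exists 1 => // z h1 h2; have := le_trans h1 h2; lra.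
have cc : continuous (fun z : R => 1 - cos (pi *+ 2 * z)).
  apply: cont_sub; first exact: cont_cst.
  move=> z; apply: (@continuous_comp _ _ _ (fun z : R => pi *+ 2 * z) cos).
    by apply: cont_mul => //; [exact: cont_cst|move=> y; exact: cvg_id].
  exact: (is_derive_continuous (fun s : R => is_derive_cos s)).
have [z0 z0in zmin] := EVT_min r12 (continuous_subspaceT cc).
exists (1 - cos (pi *+ 2 * z0)).
  rewrite subr_gt0; apply: cos_lt1; move: z0in; rewrite in_itv /= => /andP[h1 h2].
  by rewrite ger0_norm; [apply/andP; split; lra|lra].
move=> z h1 h2; have := zmin `|z|; rewrite in_itv /= h1 h2 => /(_ isT).
suff -> : cos (pi *+ 2 * `|z|) = cos (pi *+ 2 * z) by [].
rewrite -[RHS]cos_norm normrM [X in _ = cos (X * _)]gtr0_norm //.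
by rewrite mulrn_wgt0 // pi_gt0.
Qed.

(** The form of continuity that Korovkin's argument takes. Move [y] to its lattice translate nearest
    to [x]: either all coordinates are within [r] and uniform continuity gives [e], or one differs
    by between [r] and [1 / 2], so its term is at least [c] and [C = 2 * B / c] absorbs the trivial
    bound [2 * B]. *)
Lemma pcont_cos_modulus k e : pcont T k -> 0 < e -> exists2 C, 0 <= C &
  forall t x y, `|k t x - k t y| <= e + C * \sum_i (1 - cos (pi *+ 2 * (x - y) 0 i)).
Proof.
move=> kp e0; have [r r0 hr] := pcont_unif T0 kp e0.
have [B B0 hB] := pcont_bounded T0 kp.
have [c c0 hc] := cos_gap r0.
have gap0 (z : R) : 0 <= 1 - cos z by rewrite subr_ge0 cos_le1.
exists (2 * B / c) => [|t x y]; first by rewrite divr_ge0 ?ltW // mulr_gt0.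
have [n hn] := reduce_mod1 x y.
have -> : k t y = k t (y + ivec R n) by have [_ [kx _]] := kp; rewrite xperiodic_ivec.
have -> : \sum_i (1 - cos (pi *+ 2 * (x - y) 0 i)) =
          \sum_i (1 - cos (pi *+ 2 * (x - (y + ivec R n)) 0 i)) :> R.
  apply: eq_bigr => i _; congr (1 - _).
  rewrite -[RHS](cos_intD _ (n i)); congr cos; rewrite !mxE; ring.
set y' := y + ivec R n.
have S0 : 0 <= \sum_i (1 - cos (pi *+ 2 * (x - y') 0 i)) :> R.
  by apply: sumr_ge0 => i _; exact: gap0.
have C0 : 0 <= 2 * B / c by rewrite divr_ge0 ?ltW // mulr_gt0.
have [/forallP h|] := boolP [forall i, `|(x - y') 0 i| <= r].
  apply: (@le_trans _ _ e); last by rewrite lerDl mulr_ge0.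
  apply: hr; first by rewrite subrr normr0 ltW.
  by apply: norm_coord_le; [exact: ltW|exact: h].
rewrite negb_forall => /existsP[i]; rewrite -ltNge => /ltW hi.
have hz : c <= 1 - cos (pi *+ 2 * (x - y') 0 i).
  apply: hc => //; have [+ _] := hn i.
  by rewrite distrC !mxE.
have : c <= \sum_i (1 - cos (pi *+ 2 * (x - y') 0 i)).
  apply: le_trans hz _; rewrite [leRHS](bigD1 i) //= lerDl.
  by apply: sumr_ge0 => j _; exact: gap0.
move=> /(ler_wpM2l C0); rewrite divfK ?gt_eqF // => h.
apply: (@le_trans _ _ (2 * B)).
  by apply: le_trans (ler_normB _ _) _; rewrite mulr2n mulrDl mul1r; exact: lerD.
by apply: le_trans h _; rewrite lerDr ltW.
Qed.

End Torus.

(** * The Poisson equation up to a small error *)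

Section Modes.
Variables (R : realType) (d : nat).

Definition phase (q : 'I_d -> int) (y x : 'rV[R]_d) : R := pi *+ 2 * dotZ q (x - y).

Lemma is_derive_phase (f f' : R -> R) q y x i :
  (forall s : R, is_derive s (1 : R) f (f' s)) ->
  is_derive x (evec R i) (fun x => f (phase q y x))
    (pi *+ 2 * (q i)%:~R * f' (phase q y x)).
Proof.
move=> df; apply/is_derive_line0.
pose w : R := pi *+ 2 * (q i)%:~R.
have E r : phase q y (x + r *: evec R i) = phase q y x + w * r.
  rewrite /phase /w -mulrA -mulrDr; congr (_ * _); rewrite /dotZ.
  rewrite (bigD1 i) //= [X in _ = X + _](bigD1 i) //= !mxE !eqxx /=.
  have -> : \sum_(j < d | j != i) (q j)%:~R * (x + r *: evec R i - y) 0 j =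
            \sum_(j < d | j != i) (q j)%:~R * (x - y) 0 j :> R.
    by apply: eq_bigr => j /negbTE ji; rewrite !mxE ji /= ?andbF mulr0 addr0.
  by rewrite mulr1; ring.
under eq_fun do rewrite E.
have dl : is_derive (0 : R) (1 : R) (fun s => phase q y x + w * s) w.
  have := is_deriveD (is_derive_cst (phase q y x) (0 : R) (1 : R))
    (is_deriveZ w (is_derive_id (0 : R) (1 : R))).
  by rewrite add0r /GRing.scale /= mulr1.
rewrite [_ * f' _]mulrC.
apply: (@is_derive1_comp R f (fun s => phase q y x + w * s) 0 _ _ _ dl).
by rewrite mulr0 addr0; exact: df.
Qed.

Lemma jet_mode (al al' : R -> R) q y :
  (forall t : R, is_derive t (1 : R) al (al' t)) ->
  jet (fun t x => al t * cos (phase q y x)) (fun t x => al' t * cos (phase q y x))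
    (fun i t x => al t * (- (pi *+ 2 * (q i)%:~R) * sin (phase q y x)))
    (fun i t x => al t * (- (pi *+ 2 * (q i)%:~R) ^+ 2 * cos (phase q y x))).
Proof.
move=> da; split=> [t x|].
  have := is_deriveZ (cos (phase q y x)) (da t).
  by rewrite /GRing.scale /= mulrC; congr is_derive; apply/funext => s; rewrite mulrC.
split=> i t x.
  have := is_deriveZ (al t) (is_derive_phase q y x i (fun s : R => is_derive_cos s)).
  by rewrite /GRing.scale /= mulrN mulNr.
apply: (is_derive_eq (is_deriveZ (al t) (is_deriveZ (- (pi *+ 2 * (q i)%:~R))
   (is_derive_phase q y x i (fun s : R => is_derive_sin s))))).
by rewrite /GRing.scale /=; ring.
Qed.

Lemma phase_cont q y : continuous (phase q y).
Proof.
apply: cont_mul; first exact: cont_cst.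
apply: cont_sum => i _; apply: cont_mul; first exact: cont_cst.
rewrite (_ : (fun x => _) = (fun x : 'rV[R]_d => x 0 i - y 0 i)); last first.
  by apply/funext => x; rewrite !mxE.
by apply: cont_sub; [exact: coord_continuous|exact: cont_cst].
Qed.

Lemma cos_cont (U : topologicalType) (f : U -> R) :
  continuous f -> continuous (fun x => cos (f x)).
Proof.
move=> cf x; apply: (@continuous_comp _ _ _ f cos); first exact: cf.
exact: (is_derive_continuous (fun s : R => is_derive_cos s)).
Qed.

Lemma pcont_mode T (k : R -> 'rV[R]_d -> R) b q y z : pcont T k ->
  pcont T (fun t x => b * (k t z * cos (phase q y x))).
Proof.
move=> kp; have [kt [kx kc]] := kp; split; first by move=> t x; rewrite kt.
split=> [t i x|].
  congr (_ * (_ * _)); rewrite -[RHS](cos_intD _ (q i)); congr cos.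
  rewrite /phase -mulrDr; congr (_ * _); rewrite addrAC /dotZ.
  rewrite (bigD1 i) //= [X in _ = X + _](bigD1 i) //= !mxE !eqxx /=.
  have -> : \sum_(j < d | j != i) (q j)%:~R * (x - y + evec R i) 0 j =
            \sum_(j < d | j != i) (q j)%:~R * (x - y) 0 j :> R.
    by apply: eq_bigr => j /negbTE ji; rewrite !mxE ji /= ?andbF addr0.
  by ring.
apply: cont_mul; first exact: cont_cst.
apply: cont_mul; first by have [_ [_ kzc]] := pcont_at z kp; exact: kzc.
apply: (@cos_cont _ (fun p : R * 'rV[R]_d => phase q y p.2)) => p.
by apply: (@continuous_comp _ _ _ snd (phase q y)); [exact: cvg_snd|exact: phase_cont].
Qed.

Lemma bounded_sum (I : finType) (F : I -> R -> 'rV[R]_d -> R) :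
  (forall w, exists B, forall t x, `|F w t x| <= B) ->
  exists B, forall t x, `|\sum_w F w t x| <= B.
Proof.
move=> /bounded_fam[B B0 hB]; exists (\sum_(w : I) B) => t x.
by apply: le_trans (ler_norm_sum _ _ _) _; apply: ler_sum.
Qed.

End Modes.

Section Poisson.
Variables (R : realType) (d : nat) (T : R).
Hypothesis T0 : 0 < T.
Variables (k kt : R -> 'rV[R]_d -> R).
Hypotheses (kp : pcont T k) (ktp : pcont T kt).
Hypothesis dk : forall t x, is_derive t (1 : R) (k ^~ x) (kt t x).

(** The Fejer approximant of [k t] is its grid mean plus modes of nonzero frequency; [w] divides
    each mode by minus its squared frequency, which inverts the Laplacian. Its coefficients are
    multiples of values of [k] at grid points, so [wt] and [g] inherit bounds from [kt] and [k]. *)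
Lemma poisson_approx e : 0 < e ->
  exists (J : finType) (pts : J -> 'rV[R]_d) (w wt : R -> 'rV[R]_d -> R)
    (g h : 'I_d -> R -> 'rV[R]_d -> R),
  [/\ (0 < #|J|)%N, pcont T w /\ jet w wt g h,
    exists2 B, 0 < B & (forall t x, `|wt t x| <= B) /\ (forall i t x, `|g i t x| <= B),
    forall t x, `|k t x - (#|J|%:R^-1 * (\sum_j k t (pts j)) + \sum_i h i t x)| <= e &
    forall t, `|torus_int (k t) - #|J|%:R^-1 * (\sum_j k t (pts j))| <= e].
Proof.
move=> e0; have e2 : 0 < e / 2 by lra.
have [C C0 hC] := pcont_cos_modulus T0 kp e2.
pose n := Num.bound (C * d%:R / (e / 2)).
have hn : C * (d%:R / n.+1%:R) <= e / 2.
  rewrite mulrA ler_pdivrMr ?ltr0n // [leRHS]mulrC -ler_pdivrMr //.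
  have q0 : 0 <= C * d%:R / (e / 2) by rewrite divr_ge0 ?mulr_ge0 // ltW.
  by apply: le_trans (ltW (archi_boundP q0)) _; rewrite ler_nat.
pose G : finType := {ffun 'I_d -> 'I_n.+2}.
pose K : finType := {ffun 'I_d -> 'I_n.+1}.
pose kap : R := (#|G|%:R * #|K|%:R)^-1.
pose I : finType := (G * K * K)%type.
pose q (w : I) : 'I_d -> int := dif w.1.2 w.2.
pose y (w : I) : 'rV[R]_d := gridpt R w.1.1.
pose Q (w : I) : R := \sum_i (pi *+ 2 * (q w i)%:~R) ^+ 2.
(* [Q w] vanishes exactly on the diagonal. Setting [a w = 0] there leaves the zero mode to the grid
   mean, and the quotient [a w / Q w] is then 0 too. *)
pose a (w : I) : R := if w.1.2 == w.2 then 0 else kap.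
have G0 : (0 < #|G|)%N by apply/card_gt0P; exists (0 : {ffun 'I_d -> 'I_n.+2}).
have K0 : (0 < #|K|)%N by apply/card_gt0P; exists [ffun=> ord0].
have Gn : #|G|%:R != 0 :> R by rewrite pnatr_eq0 -lt0n.
have Kn : #|K|%:R != 0 :> R by rewrite pnatr_eq0 -lt0n.
have qn0 w : a w != 0 -> exists i, q w i != 0.
  rewrite /a; case: ifP => [_|/negbT kl _]; first by rewrite eqxx.
  by move: kl; rewrite -dif_eq0 negb_forall => /existsP.
have Q0 w : a w != 0 -> Q w != 0.
  move=> /qn0[i qi]; rewrite gt_eqF // /Q (bigD1 i) //=; apply: ltr_pwDl.
    by rewrite exprn_even_gt0 //= mulf_neq0 ?intr_eq0 // gt_eqF // mulrn_wgt0 // pi_gt0.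
  by apply: sumr_ge0 => j _; exact: sqr_ge0.
(* The diagonal pairs make up the grid mean: [#|K|] terms [kap] per grid point add up to
   [1 / #|G|]. *)
have split_approx t x : \sum_(j : G) k t (gridpt R j) * fejer j x =
    #|G|%:R^-1 * (\sum_(j : G) k t (gridpt R j)) +
    \sum_w a w * (k t (y w) * cos (phase (q w) (y w) x)).
  have -> : #|G|%:R^-1 * (\sum_(j : G) k t (gridpt R j)) =
      \sum_(w : I) (if w.1.2 == w.2 then kap else 0) *
         (k t (y w) * cos (phase (q w) (y w) x)).
    rewrite -(pair_bigA _ (fun (p : G * K) l => (if p.2 == l then kap else 0) *
         (k t (gridpt R p.1) * cos (phase (dif p.2 l) (gridpt R p.1) x)))) /=.
    rewrite -(pair_bigA _ (fun (j : G) (k1 : K) => \sum_l (if k1 == l then kap else 0) *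
         (k t (gridpt R j) * cos (phase (dif k1 l) (gridpt R j) x)))) /=.
    rewrite mulr_sumr; apply: eq_bigr => j _.
    rewrite (eq_bigr (fun=> kap * k t (gridpt R j))) => [|k1 _].
      rewrite sumr_const -(mulr_natl _ #|K|) mulrA; congr (_ * _).
      by rewrite /kap; field; rewrite Kn Gn.
    rewrite (bigD1 k1) //= eqxx big1 => [|l lk]; last by rewrite eq_sym (negbTE lk) mul0r.
    rewrite addr0 /phase /dotZ big1 ?mulr0 ?cos0 ?mulr1 // => i _.
    by rewrite /dif subrr mul0r.
  rewrite -big_split /=.
  rewrite (eq_bigr (fun w : I => kap * (k t (y w) * cos (phase (q w) (y w) x)))) => [|w _];
    last first.
    by rewrite -mulrDl /a; case: ifP; rewrite ?addr0 ?add0r.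
  rewrite -(pair_bigA _ (fun (p : G * K) l => kap *
         (k t (gridpt R p.1) * cos (phase (dif p.2 l) (gridpt R p.1) x)))) /=.
  rewrite -(pair_bigA _ (fun (j : G) (k1 : K) => \sum_l kap *
         (k t (gridpt R j) * cos (phase (dif k1 l) (gridpt R j) x)))) /=.
  apply: eq_bigr => j _; rewrite /fejer -/kap mulrCA mulr_sumr mulr_sumr.
  apply: eq_bigr => k1 _; rewrite !mulr_sumr; apply: eq_bigr => l _.
  by rewrite /phase.
have close t x : `|k t x - (#|G|%:R^-1 * (\sum_(j : G) k t (gridpt R j)) +
    \sum_w a w * (k t (y w) * cos (phase (q w) (y w) x)))| <= e.
  rewrite -split_approx; have hf := fejer_approx n (f := k t) C0 (hC t x).
  apply: le_trans hf _.
  by rewrite [leRHS]splitr lerD2l.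
have jw w := jet_scale (- (a w / Q w)) (jet_mode (q w) (y w) (fun t => dk t (y w))).
exists G, (gridpt R (n := n)).
exists (fun t x => \sum_w - (a w / Q w) * (k t (y w) * cos (phase (q w) (y w) x))).
eexists; eexists; eexists; split => //.
- split; last exact: (jet_sum (index_enum I) jw).
  by apply: pcont_sum => w; exact: pcont_mode.
- have [Bt Bt0 hBt] := pcont_bounded T0 ktp; have [Bk Bk0 hBk] := pcont_bounded T0 kp.
  have b1 : exists B, forall t x,
      `|\sum_w - (a w / Q w) * (kt t (y w) * cos (phase (q w) (y w) x))| <= B.
    apply: bounded_sum => w; exists (`|- (a w / Q w)| * (Bt * 1)) => t x.
    rewrite !normrM; apply: ler_wpM2l => //; apply: ler_pM => //; exact: cos_max.
  have b2 i : exists B, forall t x,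
      `|\sum_w - (a w / Q w) * (k t (y w) *
          (- (pi *+ 2 * (q w i)%:~R) * sin (phase (q w) (y w) x)))| <= B.
    apply: bounded_sum => w.
    exists (`|- (a w / Q w)| * (Bk * (`|- (pi *+ 2 * (q w i)%:~R)| * 1))) => t x.
    rewrite 2!normrM [X in _ * (_ * X)]normrM; apply: ler_wpM2l => //.
    by apply: ler_pM => //; apply: ler_wpM2l => //; exact: sin_max.
  have [B1 hB1] := b1; have [B2 B20 hB2] := bounded_fam b2.
  have B10 := le_trans (normr_ge0 _) (hB1 0 0).
  exists (B1 + B2); first by rewrite ltr_wpDl.
  split=> [t x|i t x]; first by apply: le_trans (hB1 t x) _; rewrite lerDl ltW.
  by apply: le_trans (hB2 i t x) _; rewrite lerDr.
- move=> t x /=; suff -> : \sum_i \sum_w - (a w / Q w) * (k t (y w) *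
     (- (pi *+ 2 * (q w i)%:~R) ^+ 2 * cos (phase (q w) (y w) x))) =
     \sum_w a w * (k t (y w) * cos (phase (q w) (y w) x)) by exact: close.
  rewrite exchange_big /=; apply: eq_bigr => w _.
  have -> : \sum_i - (a w / Q w) * (k t (y w) *
     (- (pi *+ 2 * (q w i)%:~R) ^+ 2 * cos (phase (q w) (y w) x))) =
     (a w / Q w * Q w) * (k t (y w) * cos (phase (q w) (y w) x)).
    rewrite {3}/Q -mulrA mulr_suml mulr_sumr; apply: eq_bigr => i _; ring.
  have [->|aw] := eqVneq (a w) 0; first by rewrite !mul0r.
  by rewrite divfK // Q0.
- move=> t; pose A (w : I) : R := - (pi *+ 2 * dotZ (q w) (y w)).
  apply: (@torus_int_close _ _ _ T0 k t I _ e (fun w => a w * k t (y w)) A q) => //.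
    by move=> w; rewrite mulf_eq0 negb_or => /andP[/qn0].
  move=> x; have := close t x.
  congr (`|_ - (_ + _)| <= _); apply: eq_bigr => w _; rewrite mulrA; congr (_ * cos _).
  by rewrite /A /phase dotZB mulrBr addrC.
Qed.

End Poisson.

(** * Large diffusion *)

Section LargeDiffusion.
Variables (R : realType) (d : nat) (T : R) (H : 'rV[R]_d -> R).
Variables (m : R -> 'rV[R]_d -> R) (lam : R -> R).
Hypothesis T0 : 0 < T.
Hypothesis HH : assumptionsH H.
Hypothesis mC : C12per T m.
Hypothesis eig : forall mu, 0 < mu -> is_eigenvalue T H m mu (lam mu).

Lemma large_limit e : 0 < e -> exists2 r, 0 < r & forall mu, r <= mu ->
  `|- lam mu - T^-1 * int_ab 0 T (fun t => torus_int (m t))| <= e.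
Proof.
move=> e0; have e4 : 0 < e / 4 by lra.
have [mp mtp mxp mxxp] := C12per_pcont mC; have [jt _] := C12per_jet mC.
have [J [pts [w [wt [g [h [J0 [wp jw] [B B0 [hwt hg]] happ htor]]]]]]] :=
  poisson_approx T0 mp mtp jt e4.
have [C C0 hC] := H_bounded HH (ltW B0).
have [beta [b0 b1 hb]] := H_superlinear HH.
have bV : 1 < beta^-1 by rewrite invf_gt1.
have bV1 : 0 < beta^-1 - 1 by lra.
have eC : 0 < e / 4 / C by apply: divr_gt0.
have [r0 r00 hr0] := powR_small bV1 eC.
pose c t := #|J|%:R^-1 * (\sum_j m t (pts j)).
pose A := #|J|%:R^-1 * (\sum_j mean T m (pts j)).
have cm z : continuous (fun s => m s z) by exact: cont_slice mp.
have AE : A = T^-1 * int_ab 0 T c.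
  rewrite /c int_abZ; last exact: cont_sum.
  by rewrite int_ab_sum ?ltW // mulrCA [X in _ = _ * X]mulr_sumr.
have Atau : `|A - T^-1 * int_ab 0 T (fun t => torus_int (m t))| <= e / 4.
  rewrite AE -mulrBr normrM gtr0_norm ?invr_gt0 // mulrC ler_pdivrMr //.
  rewrite -[X in _ * X]subr0; apply: int_ab_dist; first exact: ltW.
  - by apply: cont_mul; [exact: cont_cst|exact: cont_sum].
  - exact: (torus_int_cont T0 mp).
  - by move=> s _; rewrite distrC; exact: htor.
(* Since [A] is the time mean of [c], the grid average of correctors has derivative [A - c]. Its
   space arguments are frozen, so it adds nothing to the gradient or the Laplacian. *)
pose al t := #|J|%:R^-1 * (\sum_j corrector T m t (pts j)).
have dal (t : R) : is_derive t (1 : R) al (A - c t).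
  have := is_deriveZ #|J|%:R^-1 (is_derive_bigsum (index_enum J)
    (fun j => corrector_dt T0 t (pts j) mp mtp jt)).
  by rewrite sumrB /GRing.scale /= mulrBr.
(* The entry 2 forces [mu^-1 < 1], as superlinearity requires; the others bring the Hamiltonian term
   and [mu^-1 * wt] below [e / 4]. *)
exists (Num.max 2 (Num.max r0^-1 (B / (e / 4)))); first by rewrite lt_max ltr0n.
move=> mu; rewrite !ge_max => /andP[mu2 /andP[mur muB]].
have mu0 : 0 < mu by lra.
have muV : 0 < mu^-1 by rewrite invr_gt0.
have [phi [phiC eqn]] := eig mu0; have [pp _ _ _] := C12per_pcont phiC.
pose psi t x := al t + mu^-1 * w t x.
have jpsi := jet_add (jet_time d dal) (jet_scale mu^-1 jw).
have psip : pcont T psi.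
  apply: pcont_add; last exact: pcont_scale.
  apply: (pcont_scale #|J|%:R^-1 (k := fun t (_ : 'rV[R]_d) => \sum_j corrector T m t (pts j))).
  by apply: pcont_sum => j; apply: pcont_at; exact: corrector_pcont.
have muwt t x : `|mu^-1 * wt t x| <= e / 4.
  rewrite normrM gtr0_norm // mulrC ler_pdivrMr //; apply: le_trans (hwt t x) _.
  by rewrite mulrC -ler_pdivrMr.
have muH t x : mu * H (\row_i (0 + mu^-1 * g i t x)) <= e / 4.
  (* Chosen so that [a ^ beta = 1 / mu], the factor in front of the gradient. *)
  pose a := mu^-1 `^ beta^-1.
  have a0 : 0 < a by apply: powR_gt0.
  have a1 : a < 1.
    have bp : 0 < beta^-1 by lra.
    have mu1 : mu^-1 < 1 by rewrite invf_lt1 //; lra.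
    have := gt0_ltr_powR bp _ _ mu1; rewrite powR1; apply; rewrite nnegrE //.
    exact: ltW.
  have ab : a `^ beta = mu^-1.
    by rewrite /a -powRrM mulVf ?gt_eqF // powRr1 // ltW.
  have -> : \row_i (0 + mu^-1 * g i t x) = a `^ beta *: \row_i g i t x.
    by apply/rowP => i; rewrite ab !mxE add0r.
  apply: (@le_trans _ _ (mu * (a * C))).
    rewrite ler_pM2l //; apply: le_trans (hb _ _ a0 a1) _.
    by rewrite ler_pM2l //; apply: hC => i; rewrite mxE.
  rewrite mulrA -ler_pdivlMr //.
  have -> : mu * a = mu^-1 `^ (beta^-1 - 1).
    rewrite powRB; last by rewrite (gt_eqF muV) implybT.
    by rewrite powRr1 ?ltW // invrK mulrC.
  by apply: hr0 => //; rewrite -[leRHS]invrK lef_pV2 // posrE ?invr_gt0.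
(* The factor [mu] cancels in the Laplacian, leaving [A] plus the Poisson error, the time term and
   the Hamiltonian term, each at most [e / 4] in size; the last is nonnegative, hence the asymmetric
   bounds. *)
have Fclose t x F : F = pde_op H m mu (fun t x => (A - c t) + mu^-1 * wt t x)
    (fun i t x => 0 + mu^-1 * g i t x) (fun i t x => 0 + mu^-1 * h i t x) t x ->
    A - e / 2 <= F <= A + 3 * (e / 4).
  have E : \sum_i (0 + mu^-1 * h i t x) = mu^-1 * \sum_i h i t x.
    by rewrite mulr_sumr; apply: eq_bigr => i _; rewrite add0r.
  move=> ->; rewrite /pde_op E mulrDr mulrN mulVKf ?gt_eqF //.
  have := happ t x; rewrite -/(c t) ler_norml => /andP[h1 h2].
  have := muwt t x; rewrite ler_norml => /andP[h3 h4].
  have h5 := muH t x.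
  have h6 : 0 <= mu * H (\row_i (0 + mu^-1 * g i t x)) by rewrite mulr_ge0 ?H_ge0 // ltW.
  by apply/andP; split; lra.
have low : A - e / 2 <= - lam mu.
  have [t [x mx]] := pcont_max T0 0 (pcont_sub pp psip) (lexx 0).
  have := eigen_ge (t := t) (x := x) (ltW mu0) phiC eqn jpsi.
  move=> /(_ _)/(le_trans _); apply; first by have /andP[] := Fclose t x _ erefl.
  by move=> t' x'; have := mx t' x'; rewrite !mul0r !subr0.
have up : - lam mu <= A + 3 * (e / 4).
  have [t [x mx]] := pcont_max T0 0 (pcont_sub psip pp) (lexx 0).
  have := eigen_le (t := t) (x := x) (ltW mu0) phiC eqn jpsi.
  move=> /(_ _)/le_trans; apply; last by have /andP[] := Fclose t x _ erefl.
  by move=> t' x'; have := mx t' x'; rewrite !mul0r !subr0.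
move: Atau; rewrite !ler_norml => /andP[h1 h2].
by apply/andP; split; lra.
Qed.

End LargeDiffusion.

Unset Implicit Arguments.

Theorem theorem1p4 (R : realType) (d : nat) (T : R) (H : 'rV[R]_d -> R)
    (m : R -> 'rV[R]_d -> R) (lam : R -> R) (x0 : 'rV[R]_d) :
  0 < T ->
  assumptionsH H ->
  C12per T m ->
  (forall mu, 0 < mu -> is_eigenvalue T H m mu (lam mu)) ->
  (forall x, T^-1 * int_ab 0 T (fun t => m t x) <= T^-1 * int_ab 0 T (fun t => m t x0)) ->
  (- lam mu @[mu --> 0^'+] --> T^-1 * int_ab 0 T (fun t => m t x0)) /\
  (- lam mu @[mu --> +oo] --> (T * 1)^-1 * int_ab 0 T (fun t => torus_int (m t))).
Proof.
move=> T0 HH mC eig mmax; split.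
  apply/cvgrPdist_le => e e0.
  have [C C0 hC] := small_upper T0 HH mC eig mmax.
  have [r r0 hr] := small_lower x0 T0 HH mC eig e0.
  have eC : 0 < e / C by apply: divr_gt0.
  near=> mu.
  have mu0 : 0 < mu by near: mu; exact: nbhs_right_gt.
  have mur : mu <= r by near: mu; exact: nbhs_right_le.
  have muC : mu <= e / C by near: mu; exact: nbhs_right_le.
  have h1 := hC _ mu0; have h2 := hr _ mu0 mur.
  rewrite ler_pdivlMr // in muC.
  rewrite -/(mean T m x0) ler_norml; apply/andP; split; lra.
apply/cvgrPdist_le => e e0; rewrite mulr1.
have [r r0 hr] := large_limit T0 HH mC eig e0.
near=> mu.
rewrite distrC; apply: hr.
by near: mu; apply: nbhs_pinfty_ge; exact: num_real.
Unshelve. all: by end_near. Qed.
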